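(* Let $(M,\varphi)$ be a $\mathrm{G}_2$ manifold with torsion forms $\tau_0,\tau_1,\tau_2,\tau_3$, let $f$ be a smooth nowhere vanishing nonconstant function on an open interval $I_f$, and let $\phi=f^3\,\varphi\wedge dt+f^4\ast_7\varphi$ be the corresponding warped $\mathrm{Spin}(7)$-structure on $N=I_f\times M$. Then the torsion forms $\lambda_1,\lambda_5$ of $\phi$ are $$\lambda_1=\frac1f(\tau_0+4f')\,dt+\frac{24}{7}\tau_1,$$ $$\lambda_5=-\frac37f^3\,\tau_1\wedge\varphi\wedge dt+\frac47f^4\,\tau_1\wedge\ast_7\varphi+f^4\,\tau_2\wedge\varphi+f^3\ast_7\tau_3\wedge dt.$$
   Context: A $\mathrm{G}_2$-structure on a 7-manifold $M$ is a 3-form $\varphi$ for which there are local coframes with $\varphi=e^{127}+e^{347}+e^{567}+e^{135}-e^{146}-e^{236}-e^{245}$; these are declared orthonormal and oriented, defining $g_\varphi$ and $\ast_7$. Its torsion forms are the unique $\tau_0\in C^\infty(M)$, $\tau_1\in\Omega^1(M)$, $\tau_2\in\Omega^2_{14}(M)=\{\beta:\beta\wedge\ast_7\varphi=0\}$, $\tau_3\in\Omega^3_{27}(M)=\{\gamma\in\Omega^3(M):\gamma\wedge\varphi=0,\ \gamma\wedge\ast_7\varphi=0\}$ with $d\varphi=\tau_0\ast_7\varphi+3\tau_1\wedge\varphi+\ast_7\tau_3$ and $d\ast_7\varphi=4\tau_1\wedge\ast_7\varphi+\tau_2\wedge\varphi$. A $\mathrm{Spin}(7)$-structure on an 8-manifold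 $N$ is a 4-form $\phi$ for which there are local coframes with $\phi=e^{1278}+e^{3478}+e^{5678}+e^{1358}-e^{1468}-e^{2368}-e^{2458}+e^{1234}+e^{1256}+e^{3456}+e^{1367}+e^{1457}+e^{2357}-e^{2467}$; these are declared orthonormal and oriented, defining $g_\phi$ and $\ast_8$. Its torsion forms are the unique $\lambda_1\in\Omega^1(N)$ and $\lambda_5\in\Omega^5_{48}(N)=\{\gamma\in\Omega^5(N):\phi\wedge\ast_8\gamma=0\}$ with $d\phi=\lambda_1\wedge\phi+\lambda_5$. On $N=I_f\times M$, $t$ is the coordinate on $I_f$, $f'=df/dt$, and forms on $M$ and functions of $t$ are identified with their pullbacks; the induced metric is $g_\phi=f^2g_\varphi+dt^2$. *)

(* Defs.v *)
From HB Require Import structures.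
From mathcomp Require Import all_boot all_order all_algebra.
From mathcomp Require Import all_classical all_reals all_analysis.

Set Implicit Arguments.
Unset Strict Implicit.
Unset Printing Implicit Defensive.

Import Order.TTheory GRing.Theory Num.Theory.
Import numFieldNormedType.Exports.

Local Open Scope classical_set_scope.
Local Open Scope ring_scope.

Section ExteriorAlgebra.
Variable R : realType.

(* The exterior algebra of the dual of R^n: [a S] is the coefficient in [a] of
   dx^{s_1} /\ ... /\ dx^{s_k}, where S = {s_1 < ... < s_k}. *)
Definition ext (n : nat) := {ffun {set 'I_n} -> R^o}.

(* The sign of the permutation sorting (A in increasing order, then B in
   increasing order), for disjoint A and B. *)
Definition shuffle_sign n (A B : {set 'I_n}) : R :=
  (-1) ^+ #|[set p : 'I_n * 'I_n | [&& p.1 \in A, p.2 \in B & (p.2 < p.1)%N]]%SET|.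

Definition wedge n (a b : ext n) : ext n :=
  [ffun S : {set 'I_n} => \sum_(A : {set 'I_n} | A \subset S)
     shuffle_sign A (S :\: A) * a A * b (S :\: A)].

Definition ext1 n : ext n := [ffun S => (S == finset.set0)%:R].

Definition dx n (i : 'I_n) : ext n := [ffun S => (S == [set i]%SET)%:R].

Definition homog n (k : nat) (a : ext n) : Prop :=
  forall S : {set 'I_n}, #|S| != k -> a S = 0.

(* The algebra morphism sending dx^i to the covector with coordinates row i E,
   that is, the pullback along the linear map with matrix E acting on column
   vectors. *)
Definition pull m n (E : 'M[R]_(m, n)) (a : ext m) : ext n :=
  \sum_(S : {set 'I_m})
     a S *: foldr (fun i => wedge (\sum_j E i j *: dx j)) (ext1 n) (enum S).

(* e^{i_1 ... i_k} = e^{i_1} /\ ... /\ e^{i_k}, with indices counted from 1. *)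
Definition mono n (s : seq nat) : ext n.+1 :=
  foldr (fun i => wedge (dx (inord i.-1))) (ext1 n.+1) s.

Definition g2_model : ext 7 :=
  mono 6 [:: 1; 2; 7]%N + mono 6 [:: 3; 4; 7]%N + mono 6 [:: 5; 6; 7]%N
  + mono 6 [:: 1; 3; 5]%N - mono 6 [:: 1; 4; 6]%N - mono 6 [:: 2; 3; 6]%N
  - mono 6 [:: 2; 4; 5]%N.

Definition spin7_model : ext 8 :=
  mono 7 [:: 1; 2; 7; 8]%N + mono 7 [:: 3; 4; 7; 8]%N
  + mono 7 [:: 5; 6; 7; 8]%N + mono 7 [:: 1; 3; 5; 8]%N
  - mono 7 [:: 1; 4; 6; 8]%N - mono 7 [:: 2; 3; 6; 8]%N
  - mono 7 [:: 2; 4; 5; 8]%N + mono 7 [:: 1; 2; 3; 4]%N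
  + mono 7 [:: 1; 2; 5; 6]%N + mono 7 [:: 3; 4; 5; 6]%N
  + mono 7 [:: 1; 3; 6; 7]%N + mono 7 [:: 1; 4; 5; 7]%N
  + mono 7 [:: 2; 3; 5; 7]%N - mono 7 [:: 2; 4; 6; 7]%N.

(* Hodge star of the Euclidean metric and standard orientation of R^n:
   dx^A |-> shuffle_sign A A^c dx^{A^c}. *)
Definition std_hodge n (a : ext n) : ext n :=
  [ffun S : {set 'I_n} =>
     shuffle_sign (finset.setC S) S * a (finset.setC S)].

(* Hodge star of the metric and orientation for which the coframe
   e^i = \sum_j E i j dx^j is orthonormal and oriented. *)
Definition coframe_hodge n (E : 'M[R]_n) (a : ext n) : ext n :=
  pull E (std_hodge (pull (invmx E) a)).

(* Coframes in which [a] takes the form [model]. *)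
Definition adapted n (model a : ext n) : set 'M[R]_n :=
  [set E | E \in unitmx /\ a = pull E model].

End ExteriorAlgebra.

Arguments ext1 {R n}.
Arguments g2_model {R}.
Arguments spin7_model {R}.

Section Calculus.
Variable R : realType.

Definition pderiv n (j : 'I_n) (g : 'rV[R]_n -> R) : 'rV[R]_n -> R :=
  fun x => 'D_(delta_mx 0 j) g x.

Fixpoint Ck n (k : nat) (U : set 'rV[R]_n) (g : 'rV[R]_n -> R) : Prop :=
  (forall x, U x -> {for x, continuous g}) /\
  if k is k'.+1 then
    forall j : 'I_n,
      (forall x, U x -> derivable g x (delta_mx 0 j)) /\ Ck k' U (pderiv j g)
  else True.

(* Meant for open U. *)
Definition smooth_on n (U : set 'rV[R]_n) (g : 'rV[R]_n -> R) : Prop :=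
  forall k, Ck k U g.

Definition smooth1_on (I : set R) (f : R -> R) : Prop :=
  forall (k : nat) (t : R), I t -> derivable (derive1n k f) t 1.

Definition jac m n (g : 'rV[R]_n -> 'rV[R]_m) (x : 'rV[R]_n) : 'M[R]_(m, n) :=
  \matrix_(i, j) pderiv j (fun y => g y 0 i) x.

End Calculus.

Section Manifolds.
Variable R : realType.

Record atlas (n : nat) := Atlas {
  pts : topologicalType;
  idx : Type;
  dom : idx -> set pts;
  chart : idx -> pts -> 'rV[R]_n }.

Definition chart_img n (M : atlas n) (i : idx M) : set 'rV[R]_n :=
  chart i @` dom i.

Definition overlap_img n (M : atlas n) (i j : idx M) : set 'rV[R]_n :=
  chart i @` (dom i `&` dom j).

(* The coordinate change (chart j) o (chart i)^-1; only its values on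
   overlap_img i j are meaningful. *)
Definition trans n (M : atlas n) (i j : idx M) (x : 'rV[R]_n) : 'rV[R]_n :=
  xget 0 [set y | exists p, [/\ dom i p, dom j p, chart i p = x & chart j p = y]].

(* Smooth n-manifold without boundary, Hausdorff and second countable. *)
Definition manifold n (M : atlas n) : Prop :=
  [/\ hausdorff_space (pts M),
      @second_countable (pts M),
      forall p : pts M, exists i, dom i p,
      forall i : idx M,
        [/\ open (dom i), {in dom i &, injective (chart i)},
            (forall p, dom i p -> {for p, continuous (chart i)}) &
            (forall V, open V -> V `<=` dom i -> open (chart i @` V))] &
      forall (i j : idx M) (k : 'I_n),
        smooth_on (overlap_img i j) (fun x => trans i j x 0 k)].

(* Mixed-degree forms given by their expressions in the charts; only the values
   of [w i] on chart_img i are meaningful, see [form_eq]. *)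
Definition dform n (M : atlas n) := idx M -> 'rV[R]_n -> ext R n.

Definition form_eq n (M : atlas n) (w v : dform M) : Prop :=
  forall (i : idx M) x, chart_img i x -> w i x = v i x.

(* w is a smooth k-form on M; the 0-forms are the smooth functions. *)
Definition Omega n (M : atlas n) (k : nat) (w : dform M) : Prop :=
  [/\ forall (i : idx M) (S : {set 'I_n}),
        smooth_on (chart_img i) (fun x => w i x S),
      forall (i : idx M) x, chart_img i x -> homog k (w i x) &
      forall (i j : idx M) x, overlap_img i j x ->
        w i x = pull (jac (trans i j) x) (w j (trans i j x))].

Definition fwedge n (M : atlas n) (w v : dform M) : dform M :=
  fun i x => wedge (w i x) (v i x).

Definition fext n (M : atlas n) (w : dform M) : dform M :=
  fun i x => \sum_(j < n)
    wedge (dx R j) [ffun S => pderiv j (fun y => w i y S) x].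

(* phi is a smooth k-form which near each point is [model] in some smooth local
   coframe. *)
Definition modelled n (M : atlas n) (k : nat) (model : ext R n)
    (phi : dform M) : Prop :=
  Omega k phi /\
  forall (i : idx M) x, chart_img i x ->
    exists (V : set 'rV[R]_n) (E : 'rV[R]_n -> 'M[R]_n),
      [/\ open V, V x, V `<=` chart_img i,
          forall a b, smooth_on V (fun y => E y a b) &
          forall y, V y -> adapted model (phi i y) (E y)].

(* Hodge star of the metric and orientation for which the coframes adapted to
   phi are orthonormal and oriented. For the two models below the stabilizers
   are the subgroups G_2 of SO(7) and Spin(7) of SO(8), so that the coframe
   chosen at each point is irrelevant. *)
Definition fhodge n (M : atlas n) (model : ext R n) (phi w : dform M) : dform M :=
  fun i x => coframe_hodge (xget 1%:M (adapted model (phi i x))) (w i x).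

End Manifolds.

Notation "w =f v" := (form_eq w v) (at level 70, no associativity).
Notation "w \^ v" := (fwedge w v) (at level 40, left associativity).

Section G2Spin7.
Variable R : realType.

Definition g2_structure (M : atlas R 7) (phi : dform M) : Prop :=
  modelled 3 g2_model phi.

Definition star7 (M : atlas R 7) (phi : dform M) : dform M -> dform M :=
  fhodge g2_model phi.

Definition Omega2_14 (M : atlas R 7) (phi b : dform M) : Prop :=
  Omega 2 b /\ b \^ star7 phi phi =f 0.

Definition Omega3_27 (M : atlas R 7) (phi c : dform M) : Prop :=
  [/\ Omega 3 c, c \^ phi =f 0 & c \^ star7 phi phi =f 0].

Definition g2_torsion (M : atlas R 7) (phi tau0 tau1 tau2 tau3 : dform M) :
    Prop :=
  [/\ Omega 0 tau0, Omega 1 tau1, Omega2_14 phi tau2 & Omega3_27 phi tau3] /\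
  fext phi =f tau0 \^ star7 phi phi + 3%:R *: (tau1 \^ phi) + star7 phi tau3 /\
  fext (star7 phi phi)
    =f 4%:R *: (tau1 \^ star7 phi phi) + tau2 \^ phi.

Definition spin7_structure (N : atlas R 8) (Phi : dform N) : Prop :=
  modelled 4 spin7_model Phi.

Definition star8 (N : atlas R 8) (Phi : dform N) : dform N -> dform N :=
  fhodge spin7_model Phi.

Definition Omega5_48 (N : atlas R 8) (Phi c : dform N) : Prop :=
  Omega 5 c /\ Phi \^ star8 Phi c =f 0.

Definition spin7_torsion (N : atlas R 8) (Phi lambda1 lambda5 : dform N) : Prop :=
  [/\ Omega 1 lambda1, Omega5_48 Phi lambda5 &
      fext Phi =f lambda1 \^ Phi + lambda5].

End G2Spin7.

Section Cylinder.
Variables (R : realType) (n : nat).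

(* The product manifold I x M, for I open in R, with coordinates
   (t, x_1, ..., x_n). *)
Definition cylinder (I : set R) (M : atlas R n) : atlas R (1 + n) :=
  @Atlas R (1 + n)
    (initial_topology (set_val : set_type I -> R) * pts M)%type (idx M)
    (fun i => [set p | dom i p.2])
    (fun i p => row_mx (const_mx (set_val (p.1 : set_type I))) (chart i p.2)).

Variables (I : set R) (M : atlas R n).

Definition pr_pull (w : dform M) : dform (cylinder I M) :=
  fun i z => pull (row_mx 0 1%:M) (w i (rsubmx z)).

(* A function of t, as a 0-form. *)
Definition tfun (h : R -> R) : dform (cylinder I M) :=
  fun i z => h (z 0 0) *: ext1.

Definition dt : dform (cylinder I M) := fun i z => dx R 0.

End Cylinder.

Arguments tfun {R n I M} h.
Arguments pr_pull {R n I M} w.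
Arguments dt {R n I M}.

Definition warped (R : realType) (M : atlas R 7) (I : set R) (f : R -> R)
    (phi : dform M) : dform (cylinder I M) :=
  tfun (fun t => f t ^+ 3) \^ pr_pull phi \^ dt
  + tfun (fun t => f t ^+ 4) \^ pr_pull (star7 phi phi).

(* Main.v *)
(* Near a point choose a coframe E adapted to phi, so that phi and *phi become the
   constant models. The coframe (f E, dt) is adapted to Phi, which gives the
   Spin(7)-structure, and d Phi is computed from the product rule and the two
   equations for d phi and d *phi. The metric-dependent condition
   Phi /\ *lambda5 = 0 is replaced by the equivalent condition
   (i_v Phi) /\ lambda5 = 0 for all v, where i_v is contraction: the equivalence
   follows from *Phi = Phi, and the new condition involves Phi only. For the
   claimed lambda5 it splits into identities between phi, *phi, tau1, tau2, tau3
   in dimension 7. It also makes the decomposition of d Phi unique, because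
   i_v Phi /\ Phi = 7 i_v vol. That the star on M does not depend on the coframe is
   the inclusion of G_2 in SO(7). *)
Require Import Defs.
From mathcomp Require Import all_boot all_order all_algebra.
From mathcomp Require Import all_classical all_reals all_analysis.
From mathcomp Require Import ring.
Set Implicit Arguments.
Unset Strict Implicit.
Unset Printing Implicit Defensive.
Import Order.TTheory GRing.Theory Num.Theory.
Import numFieldNormedType.Exports.
Local Open Scope ring_scope.

(** * Exterior algebra *)

(** The constant 24/7 is forced. If [lambda1] contains x tau1, then [lambda5] contains (3 - x) f^3
    tau1 /\ phi /\ dt + (4 - x) f^4 tau1 /\ psi, where psi is the star of phi. In the contraction
    condition these two terms meet only each other, through (i_w psi) /\ tau1 /\ phi = -(4/3) (i_w
    phi) /\ tau1 /\ psi, and the condition becomes (4 - x) + (4/3) (3 - x) = 0. Hence x = 24/7, with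
    remainders 3 - x = -3/7 and 4 - x = 4/7. The obstacle is that both stars are built on a coframe
    selected by [xget] separately at each point. A priori the star on M has neither regularity nor a
    transformation law between charts; both have to be recovered before it can be differentiated or
    counted as a form. The identities between the models involve up to 256 coefficients. They are
    decided by a normalisation procedure for integral combinations of monomials, run on basis
    vectors only; linearity extends them to all vectors, and [pull] carries them to arbitrary
    coframes. *)

Lemma disjoint_setUl (T : finType) (A B C : {set T}) :
  [disjoint A :|: B & C] = [disjoint A & C] && [disjoint B & C].
Proof. by rewrite -!setI_eq0 finset.setIUl finset.setU_eq0. Qed.

Lemma disjoint_setUr (T : finType) (A B C : {set T}) :
  [disjoint A & B :|: C] = [disjoint A & B] && [disjoint A & C].
Proof. by rewrite -!setI_eq0 finset.setIUr finset.setU_eq0. Qed.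

(** * Signs of shuffles *)

Section Signs.
Variables (R : realType) (n : nat).
Implicit Types A B C S T : {set 'I_n}.
Local Notation sg := (@shuffle_sign R n).

Lemma shuffle_signUl A B C : [disjoint A & B] -> sg (A :|: B) C = sg A C * sg B C.
Proof.
move=> AB; rewrite /shuffle_sign -exprD; congr (_ ^+ _).
rewrite -cardsUI [X in (_ + #|pred_of_set X|)%N](_ : _ = finset.set0) ?cards0 ?addn0.
  by apply: eq_card => p; rewrite !inE andb_orl.
apply/setP => -[i j]; rewrite !inE /=; apply/negP => /andP[/and3P[iA _ _] /and3P[iB _ _]].
by move/pred0P/(_ i): AB; rewrite /= iA iB.
Qed.

Lemma shuffle_signUr A B C : [disjoint B & C] -> sg A (B :|: C) = sg A B * sg A C.
Proof.
move=> AB; rewrite /shuffle_sign -exprD; congr (_ ^+ _).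
rewrite -cardsUI [X in (_ + #|pred_of_set X|)%N](_ : _ = finset.set0) ?cards0 ?addn0.
  apply: eq_card => p; rewrite !inE.
  by case: (_ \in A); case: (_ \in B); case: (_ \in C) => //=; rewrite ?orbb ?orbF.
apply/setP => -[i j]; rewrite !inE /=; apply/negP => /andP[/and3P[_ iA _] /and3P[_ iB _]].
by move/pred0P/(_ j): AB; rewrite /= iA iB.
Qed.

Lemma shuffle_sign0l A : sg finset.set0 A = 1.
Proof.
by rewrite /shuffle_sign (_ : [set _ | _]%SET = finset.set0) ?cards0 ?expr0 //;
   apply/setP => p; rewrite !inE.
Qed.

Lemma shuffle_sign0r A : sg A finset.set0 = 1.
Proof.
by rewrite /shuffle_sign (_ : [set _ | _]%SET = finset.set0) ?cards0 ?expr0 //;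
   apply/setP => p; rewrite !inE andbF.
Qed.

Lemma shuffle_sign11 i j : sg [set i]%SET [set j]%SET = (-1) ^+ (j < i)%N.
Proof.
rewrite /shuffle_sign; congr (_ ^+ _).
rewrite (_ : [set _ | _]%SET = if (j < i)%N then [set (i, j)]%SET else finset.set0).
  by case: ifP; rewrite ?cards0 ?cards1.
apply/setP => -[a b]; rewrite !inE /=; case: ifP => ji; rewrite !inE /= ?xpair_eqE.
  by case: eqP => //= ->; case: eqP => //= ->.
by case: eqP => //= ->; case: eqP => //= ->.
Qed.

Lemma shuffle_sign_sq A B : sg A B * sg A B = 1.
Proof. by rewrite /shuffle_sign -expr2 sqrr_sign. Qed.

(** Every pair in A x B is an inversion for exactly one of the two orders, because A and B share no
    index; the two exponents therefore add up to the number of pairs. *)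
Lemma shuffle_signC A B : [disjoint A & B] -> sg A B * sg B A = (-1) ^+ (#|A| * #|B|).
Proof.
move=> AB; rewrite /shuffle_sign -exprD; congr (_ ^+ _).
pose sw (p : 'I_n * 'I_n) := (p.2, p.1).
have swI : injective sw by move=> [a b] [c d] [-> ->].
rewrite -cardsX -(card_imset [set p | [&& p.1 \in B, p.2 \in A & (p.2 < p.1)%N]]%SET swI).
rewrite -cardsUI [X in (_ + #|pred_of_set X|)%N](_ : _ = finset.set0) ?cards0 ?addn0.
  apply: eq_card => -[i j]; rewrite !inE /= -[in X in _ || X]/(sw (j, i)) mem_imset //.
  rewrite !inE /=; case iA: (i \in A) => //=; case jB: (j \in B) => //=; rewrite ?andbF //.
  have : i != j by apply: contraTneq AB => ij; apply/pred0Pn; exists i; rewrite /= iA ij jB.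
  by rewrite -(inj_eq val_inj) neq_ltn orbC.
apply/setP => -[i j]; rewrite !inE /=; apply/negP => /andP[/and3P[_ _ ij]].
by rewrite -/(sw (j, i)) mem_imset // !inE /= => /and3P[_ _]; rewrite ltnNge (ltnW ij).
Qed.

End Signs.

(** * The graded algebra of forms on its monomial basis *)

Section Ext.
Variables (R : realType) (n : nat).
Implicit Types (A B C S T : {set 'I_n}) (a b c : ext R n).
Local Notation sg := (@shuffle_sign R n).

Definition ebasis S : ext R n := [ffun T => (T == S)%:R].

Lemma ext_basis a : a = \sum_S a S *: ebasis S.
Proof.
apply/ffunP => T; rewrite sum_ffunE (bigD1 T) //= !ffunE eqxx big1 ?addr0.
  by rewrite /GRing.scale /= mulr1.
by move=> S ST; rewrite !ffunE eq_sym (negbTE ST) /GRing.scale /= mulr0.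
Qed.

Lemma ext_basis_ind (P : ext R n -> Prop) :
  (forall (k : R) a b, P a -> P b -> P (k *: a + b)) -> P 0 -> (forall S, P (ebasis S)) ->
  forall a, P a.
Proof.
move=> Pl P0 Pb a; rewrite (ext_basis a).
elim/big_ind: _ => [//|x y Px Py|S _]; first by rewrite -[x]scale1r; apply: Pl.
by rewrite -[_ *: _]addr0; apply: Pl.
Qed.

Lemma homog_ind k (P : ext R n -> Prop) :
  (forall (c : R) a b, P a -> P b -> P (c *: a + b)) -> P 0 ->
  (forall S, #|S| = k -> P (ebasis S)) ->
  forall a, homog k a -> P a.
Proof.
move=> Pl P0 Pb a ha; rewrite (ext_basis a).
elim/big_ind: _ => [//|x y Px Py|S _]; first by rewrite -[x]scale1r; apply: Pl.
have [Sk|/ha->] := eqVneq #|S| k; last by rewrite scale0r.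
by rewrite -[_ *: _]addr0; apply: Pl => //; exact: Pb.
Qed.

Lemma dxE i : dx R i = ebasis [set i]%SET. Proof. by []. Qed.
Lemma ext1E : ext1 = ebasis finset.set0. Proof. by []. Qed.

Lemma wedgeDl a b c : wedge (a + b) c = wedge a c + wedge b c.
Proof.
apply/ffunP => S; rewrite !ffunE -big_split /=; apply: eq_bigr => A _.
by rewrite ffunE mulrDr mulrDl.
Qed.

Lemma wedgeDr a b c : wedge a (b + c) = wedge a b + wedge a c.
Proof.
apply/ffunP => S; rewrite !ffunE -big_split /=; apply: eq_bigr => A _.
by rewrite ffunE mulrDr.
Qed.

Lemma wedgeZl (k : R) a b : wedge (k *: a) b = k *: wedge a b.
Proof.
apply/ffunP => S; rewrite !ffunE scaler_sumr /=; apply: eq_bigr => A _.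
by rewrite ffunE /GRing.scale /= mulrCA !mulrA.
Qed.

Lemma wedgeZr (k : R) a b : wedge a (k *: b) = k *: wedge a b.
Proof.
apply/ffunP => S; rewrite !ffunE scaler_sumr /=; apply: eq_bigr => A _.
by rewrite ffunE /GRing.scale /= mulrCA !mulrA.
Qed.

Lemma wedge0l a : wedge 0 a = 0.
Proof. by have := wedgeZl 0 0 a; rewrite !scale0r. Qed.
Lemma wedge0r a : wedge a 0 = 0.
Proof. by have := wedgeZr 0 a 0; rewrite !scale0r. Qed.
Lemma wedgeNl a b : wedge (- a) b = - wedge a b.
Proof. by rewrite -scaleN1r wedgeZl scaleN1r. Qed.
Lemma wedgeNr a b : wedge a (- b) = - wedge a b.
Proof. by rewrite -scaleN1r wedgeZr scaleN1r. Qed.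

Lemma wedge_suml (I : Type) (r : seq I) (P : pred I) (F : I -> ext R n) b :
  wedge (\sum_(i <- r | P i) F i) b = \sum_(i <- r | P i) wedge (F i) b.
Proof. by apply: (big_morph (fun a => wedge a b)) => [x y|]; rewrite ?wedgeDl ?wedge0l. Qed.
Lemma wedge_sumr (I : Type) (r : seq I) (P : pred I) (F : I -> ext R n) a :
  wedge a (\sum_(i <- r | P i) F i) = \sum_(i <- r | P i) wedge a (F i).
Proof. by apply: (big_morph (wedge a)) => [x y|]; rewrite ?wedgeDr ?wedge0r. Qed.

Lemma wedge_ebasis A B :
  wedge (ebasis A) (ebasis B) = if [disjoint A & B] then sg A B *: ebasis (A :|: B) else 0.
Proof.
apply/ffunP => S; rewrite !ffunE.
have [AS|AS] := boolP (A \subset S); last first.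
  rewrite big1 => [|C CS].
    case: ifP => _; rewrite !ffunE //; case: eqP => [E|_]; last by rewrite /GRing.scale /= mulr0.
    by rewrite E finset.subsetUl in AS.
  by rewrite !ffunE (_ : (C == A) = false) ?mulr0 ?mul0r //; apply: contraNF AS => /eqP<-.
rewrite (bigD1 A) //= !ffunE eqxx mulr1 big1 ?addr0 => [|C /andP[CS CA]]; last first.
  by rewrite !ffunE (negbTE CA) mulr0 mul0r.
have [<-|SB] := eqVneq (S :\: A) B.
  rewrite mulr1 (_ : [disjoint _ & _]) ?ffunE; last first.
    by rewrite -setI_eq0; apply/eqP/setP => x; rewrite !inE; case: (_ \in A).
  rewrite (_ : S == _) /GRing.scale /= ?mulr1 //.
  by apply/eqP/setP => x; rewrite !inE; have := fintype.subsetP AS x; case: (_ \in A) => //= ->.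
rewrite mulr0; case: ifP => [AB|_]; rewrite !ffunE //.
rewrite (_ : S == _ = false) /GRing.scale /= ?mulr0 //; apply: contraNF SB => /eqP->.
apply/eqP/setP => x; rewrite !inE.
by have := disjointFr AB (x := x); case: (_ \in A) => //= ->.
Qed.

(** By trilinearity only monomials matter. Both sides vanish unless A, B, C are pairwise disjoint,
    and then both carry the sign sg A B * sg A C * sg B C, since the shuffle sign is multiplicative
    in each argument. *)
Lemma wedgeA a b c : wedge a (wedge b c) = wedge (wedge a b) c.
Proof.
elim/ext_basis_ind: a => [k x y||A]; first by rewrite !(wedgeDl, wedgeZl) => -> ->.
  by rewrite !wedge0l.
elim/ext_basis_ind: b => [k x y||B];
  first by rewrite !(wedgeDl, wedgeZl, wedgeDr, wedgeZr) => -> ->.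
  by rewrite !(wedge0l, wedge0r).
elim/ext_basis_ind: c => [k x y||C]; first by rewrite !(wedgeDr, wedgeZr) => -> ->.
  by rewrite !wedge0r.
rewrite !wedge_ebasis.
have [AB|AB] := boolP [disjoint A & B]; have [BC|BC] := boolP [disjoint B & C];
  rewrite ?wedge0l ?wedge0r ?wedgeZl ?wedgeZr ?wedge_ebasis //.
- rewrite disjoint_setUl disjoint_setUr AB BC /= andbT; case: ifP => [AC|_];
  last by rewrite !scaler0.
  by rewrite !scalerA shuffle_signUl // shuffle_signUr // finset.setUA; congr (_ *: _); ring.
- by rewrite disjoint_setUl (negbTE BC) andbF scaler0.
- by rewrite disjoint_setUr (negbTE AB) scaler0.
Qed.

Lemma wedge1l a : wedge ext1 a = a.
Proof.
elim/ext_basis_ind: a => [k x y||A]; first by rewrite wedgeDr wedgeZr => -> ->.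
  by rewrite wedge0r.
by rewrite ext1E wedge_ebasis -setI_eq0 finset.set0I eqxx finset.set0U shuffle_sign0l scale1r.
Qed.

Lemma wedge1r a : wedge a ext1 = a.
Proof.
elim/ext_basis_ind: a => [k x y||A]; first by rewrite wedgeDl wedgeZl => -> ->.
  by rewrite wedge0l.
by rewrite ext1E wedge_ebasis -setI_eq0 finset.setI0 eqxx finset.setU0 shuffle_sign0r scale1r.
Qed.

Lemma homogD k a b : homog k a -> homog k b -> homog k (a + b).
Proof. by move=> ha hb S Sk; rewrite ffunE ha // hb // addr0. Qed.
Lemma homogZ k (x : R) a : homog k a -> homog k (x *: a).
Proof. by move=> ha S Sk; rewrite ffunE ha // scaler0. Qed.
Lemma homogN k a : homog k a -> homog k (- a).
Proof. by rewrite -scaleN1r; exact: homogZ. Qed.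
Lemma homog0 k : homog k (0 : ext R n).
Proof. by move=> S _; rewrite ffunE. Qed.
Lemma homog_sum k (I : Type) (r : seq I) (P : pred I) (F : I -> ext R n) :
  (forall i, P i -> homog k (F i)) -> homog k (\sum_(i <- r | P i) F i).
Proof. by move=> h; elim/big_ind: _; [exact: homog0|exact: homogD|]. Qed.
Lemma homog_ebasis S : homog #|S| (ebasis S).
Proof. by move=> T; rewrite ffunE; have [->|] := eqVneq T S; rewrite ?eqxx. Qed.
Lemma homog_dx i : homog 1 (dx R i : ext R n).
Proof. by rewrite dxE -(cards1 i); exact: homog_ebasis. Qed.
Lemma homog_ext1 : homog 0 (ext1 : ext R n).
Proof. by rewrite ext1E -(cards0 'I_n); exact: homog_ebasis. Qed.

Lemma homog_wedge p q a b : homog p a -> homog q b -> homog (p + q) (wedge a b).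
Proof.
move=> ha; elim/homog_ind : ha b => [k x y hx hy b hb||A Ap b].
- by rewrite wedgeDl wedgeZl; apply: homogD; [apply: homogZ; exact: hx|exact: hy].
- by move=> b _; rewrite wedge0l; exact: homog0.
elim/homog_ind => [k x y hx hy||B Bq].
- by rewrite wedgeDr wedgeZr; apply: homogD; [exact: homogZ|].
- by rewrite wedge0r; exact: homog0.
rewrite wedge_ebasis; case: ifP => [AB|_]; last exact: homog0.
apply: homogZ; rewrite (_ : (p + q)%N = #|A :|: B|); first exact: homog_ebasis.
by rewrite -Ap -Bq; apply/esym/eqP; rewrite (leq_card_setU A B).2.
Qed.

Lemma homog_gt k a : (n < k)%N -> homog k a -> a = 0.
Proof.
move=> nk ha; apply/ffunP => S; rewrite ffunE ha // neq_ltn (leq_ltn_trans _ nk) //.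
by rewrite -[leqRHS]card_ord max_card.
Qed.

Lemma wedgeC p q a b : homog p a -> homog q b ->
  wedge a b = (-1) ^+ (p * q) *: wedge b a.
Proof.
move=> ha; elim/homog_ind : ha b => [k x y hx hy b hb||A Ap b].
- by rewrite wedgeDl wedgeZl hx // hy // wedgeDr wedgeZr scalerDr !scalerA [k * _]mulrC.
- by move=> b _; rewrite wedge0l wedge0r scaler0.
elim/homog_ind => [k x y hx hy||B Bq].
- by rewrite wedgeDr wedgeZr hx hy wedgeDl wedgeZl scalerDr !scalerA [k * _]mulrC.
- by rewrite wedge0l wedge0r scaler0.
rewrite !wedge_ebasis disjoint_sym; case: ifP => [AB|_]; last by rewrite scaler0.
rewrite scalerA finset.setUC -Ap -Bq -shuffle_signC; last by rewrite disjoint_sym.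
by rewrite -mulrA shuffle_sign_sq mulr1.
Qed.

Lemma wedge_dx_anti i j : wedge (dx R i) (dx R j) = - wedge (dx R j) (dx R i : ext R n).
Proof. by rewrite (wedgeC (homog_dx i) (homog_dx j)) expr1 scaleN1r. Qed.

Lemma wedge_dx_sq i : wedge (dx R i) (dx R i) = 0 :> ext R n.
Proof. by rewrite dxE wedge_ebasis disjoints1 inE eqxx. Qed.

End Ext.

(** * Monomials as ordered products of covectors *)

Lemma sorted_enum_set n (S : {set 'I_n}) : sorted (fun i j : 'I_n => (i < j)%N) (enum S).
Proof.
rewrite /enum_mem; apply: sorted_filter; first by move=> i j k; exact: ltn_trans.
by have := iota_ltn_sorted 0 n; rewrite -val_enum_ord sorted_map enumT.
Qed.

(** A strictly increasing list is determined by its members, so the enumeration can be cut at i. The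
    length of [s1] is the number of transpositions that bring a new factor i into place. *)
Lemma enum_set_split n (i : 'I_n) (S : {set 'I_n}) : i \notin S ->
  let s1 := [seq j : 'I_n <- enum S | (j < i)%N] in
  let s2 := [seq j : 'I_n <- enum S | (i < j)%N] in
  enum S = s1 ++ s2 /\ enum (i |: S)%SET = s1 ++ i :: s2.
Proof.
move=> iS s1 s2.
have ms1 j : j \in s1 = (j < i)%N && (j \in S) by rewrite mem_filter mem_enum.
have ms2 j : j \in s2 = (i < j)%N && (j \in S) by rewrite mem_filter mem_enum.
have tr : transitive (fun i j : 'I_n => (i < j)%N) by move=> a b c; exact: ltn_trans.
have ir : irreflexive (fun i j : 'I_n => (i < j)%N) by move=> a; exact: ltnn.
have st1 : sorted (fun i j : 'I_n => (i < j)%N) (s1 ++ i :: s2).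
  rewrite sorted_pairwise // pairwise_cat /= -!sorted_pairwise //.
  have -> := sorted_filter tr (fun j : 'I_n => (j < i)%N) (sorted_enum_set S).
  have -> := sorted_filter tr (fun j : 'I_n => (i < j)%N) (sorted_enum_set S).
  rewrite andbT /=; apply/andP; split; last first.
    by apply/allP => j; rewrite ms2 => /andP[].
  apply/allrelP => a b; rewrite in_cons ms1 ms2 => /andP[ai _] /orP[/eqP->//|/andP[ib _]].
  exact: ltn_trans ib.
split.
  apply: (irr_sorted_eq tr ir); first exact: sorted_enum_set.
    apply: subseq_sorted st1 => //; apply: cat_subseq => //; exact: subseq_cons.
  move=> j; rewrite mem_enum mem_cat ms1 ms2.
  case jS: (j \in S); rewrite ?andbF //= !andbT.
  by rewrite -neq_ltn (inj_eq val_inj); apply/esym; apply: contraNneq iS => <-.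
apply: (irr_sorted_eq tr ir) => //; first exact: sorted_enum_set.
move=> j; rewrite mem_enum mem_cat in_cons ms1 ms2 finset.in_setU1.
have [->|ji] := eqVneq j i; first by rewrite ltnn.
case jS: (j \in S); rewrite ?andbF //= !andbT.
by rewrite -neq_ltn (inj_eq val_inj) ji.
Qed.

Lemma shuffle_sign1l (R : realType) n (i : 'I_n) (S : {set 'I_n}) :
  shuffle_sign R [set i]%SET S = (-1) ^+ size [seq j : 'I_n <- enum S | (j < i)%N].
Proof.
rewrite /shuffle_sign; congr (_ ^+ _).
have pi : injective (pair i : 'I_n -> 'I_n * 'I_n) by move=> a b [].
set s := [seq _ <- _ | _].
have <- : #|s| = size s by apply/card_uniqP; rewrite filter_uniq ?enum_uniq.
rewrite -(card_imset (mem s) pi).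
apply: eq_card => -[a b]; rewrite !inE /=; apply/and3P/imsetP => [[/eqP-> bS bi]|[c]].
  by exists b => //; rewrite mem_filter mem_enum bS bi.
by rewrite mem_filter mem_enum => /andP[ci cS] [-> ->].
Qed.

Section Blade.
Variables (R : realType) (m n : nat).

(** With [F] the rows of a matrix and [s = enum S] this is the product occurring in [pull]; with [F]
    the coordinate covectors it is the monomial itself. Only anticommutation of the [F i] is used,
    so one sign rule serves both. *)
Definition blade (F : 'I_m -> ext R n) (s : seq 'I_m) : ext R n :=
  foldr (fun i => wedge (F i)) ext1 s.

Variable F : 'I_m -> ext R n.
Hypothesis Fanti : forall i j, wedge (F i) (F j) = - wedge (F j) (F i).

Lemma anti_sq i : wedge (F i) (F i) = 0.
Proof.
have /eqP := Fanti i i; rewrite -subr_eq0 opprK -mulr2n -scaler_nat.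
by rewrite scaler_eq0 pnatr_eq0 => /eqP.
Qed.

Lemma blade_ins i s1 s2 :
  wedge (F i) (blade F (s1 ++ s2)) = (-1 : R) ^+ size s1 *: blade F (s1 ++ i :: s2).
Proof.
elim: s1 => [|j s1 IH] /=; first by rewrite scale1r.
by rewrite wedgeA Fanti wedgeNl -wedgeA IH wedgeZr exprS mulN1r scaleNr.
Qed.

Lemma blade_mem i s : i \in s -> wedge (F i) (blade F s) = 0.
Proof.
case/splitPr => s1 s2; rewrite blade_ins.
have -> : blade F (s1 ++ [:: i, i & s2]) = 0; last by rewrite scaler0.
elim: s1 => [|j s1 IH] /=; last by rewrite IH wedge0r.
by rewrite wedgeA anti_sq wedge0l.
Qed.

Lemma blade_enum i (S : {set 'I_m}) :
  wedge (F i) (blade F (enum S)) =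
  if i \in S then 0 else shuffle_sign R [set i]%SET S *: blade F (enum (i |: S)%SET).
Proof.
case: ifP => [iS|/negbT iS]; first by rewrite blade_mem // mem_enum.
have [E1 E2] := enum_set_split iS.
by rewrite {1}E1 E2 blade_ins shuffle_sign1l.
Qed.

End Blade.

Section Basis.
Variables (R : realType) (n : nat).
Implicit Types (S T : {set 'I_n}) (a b : ext R n).
Local Notation sg := (@shuffle_sign R n).

Lemma wedge_dx_ebasis j T :
  wedge (dx R j) (ebasis R T) = if j \in T then 0 else sg [set j]%SET T *: ebasis R (j |: T)%SET.
Proof.
rewrite dxE wedge_ebasis disjoints1.
by case: (j \in T).
Qed.

Lemma ebasis_blade S : ebasis R S = blade (@dx R n) (enum S).
Proof.
move: {2}#|S| (leqnn #|S|) => k; elim: k => [|k IH] in S *.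
  by rewrite leqn0 cards_eq0 => /eqP->; rewrite enum_set0.
have [->|[i iS]] := set_0Vmem S; first by rewrite enum_set0.
rewrite (cardsD1 i) iS ltnS => /IH E.
have := blade_enum (@wedge_dx_anti R n) i (S :\ i).
rewrite -E wedge_dx_ebasis !finset.inE eqxx /= finset.setD1K //.
(* Both expressions for dx i wedged with the monomial of S without i carry the same sign, which is
   its own inverse. *)
move/(congr1 (GRing.scale (sg [set i]%SET (S :\ i)))).
by rewrite !scalerA shuffle_sign_sq !scale1r.
Qed.

(** Homogeneous forms arise from 1 by adding covector factors. The predicate sees the degree, so
    that factors such as [s ^+ k] can be tracked. *)
Lemma homog_dx_ind (P : nat -> ext R n -> Prop) :
  (forall k (c : R) a b, P k a -> P k b -> P k (c *: a + b)) -> (forall k, P k 0) ->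
  P 0 ext1 -> (forall k i a, homog k a -> P k a -> P k.+1 (wedge (dx R i) a)) ->
  forall k a, homog k a -> P k a.
Proof.
move=> Pl P0 P1 Pw k; apply: homog_ind => [c a b|//|S <-]; first exact: Pl.
rewrite ebasis_blade cardE; set s := enum S.
suff [] : homog (size s) (blade (@dx R n) s) /\ P (size s) (blade (@dx R n) s) by [].
elim: s => [|i s [hs Ps]] /=; first by split => //; exact: homog_ext1.
by split; [exact: (homog_wedge (homog_dx R i) hs)|exact: Pw].
Qed.

(** The variant suited to the Hodge star, which turns a factor added on the right into a
    contraction. *)
Lemma homog_dx_indr (P : nat -> ext R n -> Prop) :
  (forall k (c : R) a b, P k a -> P k b -> P k (c *: a + b)) -> (forall k, P k 0) ->
  P 0 ext1 -> (forall k i a, homog k a -> P k a -> P k.+1 (wedge a (dx R i))) ->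
  forall k a, homog k a -> P k a.
Proof.
move=> Pl P0 P1 Pw; apply: homog_dx_ind => // k i a ha Pa.
rewrite (wedgeC (homog_dx R i) ha) -[_ *: _]addr0.
by apply: Pl => //; exact: Pw.
Qed.

Lemma ext_dx_ind (P : ext R n -> Prop) :
  (forall (k : R) a b, P a -> P b -> P (k *: a + b)) -> P 0 ->
  P ext1 -> (forall i a, P a -> P (wedge (dx R i) a)) -> forall a, P a.
Proof.
move=> Pl P0 P1 Pw; apply: ext_basis_ind => [c a b|//|S]; first exact: Pl.
rewrite ebasis_blade.
by elim: (enum S) => //= i s IH; exact: Pw.
Qed.

End Basis.

(** * Pullback along a linear map *)

Section Pull.
Variable R : realType.

Definition cov m n (E : 'M[R]_(m, n)) (i : 'I_m) : ext R n := \sum_j E i j *: dx R j.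

Lemma cov_anti m n (E : 'M[R]_(m, n)) i j :
  wedge (cov E i) (cov E j) = - wedge (cov E j) (cov E i).
Proof.
rewrite /cov wedge_suml wedge_suml.
under eq_bigr do rewrite wedge_sumr.
rewrite exchange_big -sumrN; apply: eq_bigr => k _ /=.
rewrite wedge_sumr -sumrN; apply: eq_bigr => l _.
by rewrite !(wedgeZl, wedgeZr) wedge_dx_anti !scalerN !scalerA mulrC.
Qed.

Lemma homog_cov m n (E : 'M[R]_(m, n)) i : homog 1 (cov E i).
Proof. by apply: homog_sum => j _; apply: homogZ; exact: homog_dx. Qed.

Lemma pullD m n (E : 'M[R]_(m, n)) a b : pull E (a + b) = pull E a + pull E b.
Proof. by rewrite -big_split; apply: eq_bigr => S _; rewrite ffunE scalerDl. Qed.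

Lemma pullZ m n (E : 'M[R]_(m, n)) (k : R) a : pull E (k *: a) = k *: pull E a.
Proof. by rewrite scaler_sumr; apply: eq_bigr => S _; rewrite ffunE scalerA. Qed.

Lemma pull0 m n (E : 'M[R]_(m, n)) : pull E 0 = 0.
Proof. by have := pullZ E 0 0; rewrite !scale0r. Qed.

Lemma pullN m n (E : 'M[R]_(m, n)) a : pull E (- a) = - pull E a.
Proof. by rewrite -scaleN1r pullZ scaleN1r. Qed.

Lemma pull_sum m n (E : 'M[R]_(m, n)) (I : Type) (r : seq I) (P : pred I) F :
  pull E (\sum_(i <- r | P i) F i) = \sum_(i <- r | P i) pull E (F i).
Proof. by apply: (big_morph (pull E)) => [x y|]; rewrite ?pullD ?pull0. Qed.

Lemma pull_ebasis m n (E : 'M[R]_(m, n)) S : pull E (ebasis R S) = blade (cov E) (enum S).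
Proof.
rewrite /pull (bigD1 S) //= ffunE eqxx scale1r big1 ?addr0 // => T TS.
by rewrite ffunE (negbTE TS) scale0r.
Qed.

Lemma pull_ext1 m n (E : 'M[R]_(m, n)) : pull E ext1 = ext1.
Proof. by rewrite ext1E pull_ebasis enum_set0. Qed.

(** The rows of E anticommute as the dx i do, so inserting a factor into an ordered product vanishes
    in the same cases and costs the same sign on both sides. Multiplicativity of [pull] follows by
    induction on the factors. *)
Lemma pull_dxl m n (E : 'M[R]_(m, n)) i b :
  pull E (wedge (dx R i) b) = wedge (cov E i) (pull E b).
Proof.
elim/ext_basis_ind: b => [k x y hx hy||S].
- by rewrite wedgeDr wedgeZr !pullD !pullZ wedgeDr wedgeZr hx hy.
- by rewrite wedge0r !pull0 wedge0r.
rewrite wedge_dx_ebasis pull_ebasis (blade_enum (@cov_anti _ _ E)).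
by case: ifP => _; rewrite ?pull0 // pullZ pull_ebasis.
Qed.

Lemma pull_dx m n (E : 'M[R]_(m, n)) i : pull E (dx R i) = cov E i.
Proof. by rewrite -[dx R i]wedge1r pull_dxl pull_ext1 wedge1r. Qed.

Lemma pull_wedge m n (E : 'M[R]_(m, n)) a b :
  pull E (wedge a b) = wedge (pull E a) (pull E b).
Proof.
elim/ext_dx_ind: a => [k x y hx hy|||i a IH].
- by rewrite wedgeDl wedgeZl !pullD !pullZ wedgeDl wedgeZl hx hy.
- by rewrite !(wedge0l, pull0).
- by rewrite pull_ext1 !wedge1l.
- by rewrite -wedgeA !pull_dxl IH wedgeA.
Qed.

Lemma pull_cov m n p (E : 'M[R]_(m, n)) (F : 'M[R]_(n, p)) i :
  pull F (cov E i) = cov (E *m F) i.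
Proof.
rewrite /cov pull_sum; under eq_bigr => j _ do rewrite pullZ pull_dx /cov scaler_sumr.
rewrite exchange_big; apply: eq_bigr => k _ /=.
by rewrite mxE scaler_suml; apply: eq_bigr => j _; rewrite scalerA.
Qed.

Lemma pull_comp m n p (E : 'M[R]_(m, n)) (F : 'M[R]_(n, p)) a :
  pull F (pull E a) = pull (E *m F) a.
Proof.
elim/ext_dx_ind: a => [k x y hx hy|||i a IH].
- by rewrite !(pullD, pullZ) hx hy.
- by rewrite !pull0.
- by rewrite !pull_ext1.
- by rewrite !pull_wedge !pull_dx pull_cov IH.
Qed.

Lemma pull1 n a : pull (1%:M : 'M[R]_n) a = a.
Proof.
elim/ext_dx_ind: a => [k x y hx hy|||i a IH].
- by rewrite !(pullD, pullZ) hx hy.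
- by rewrite !pull0.
- by rewrite !pull_ext1.
rewrite pull_dxl IH; congr wedge; rewrite /cov (bigD1 i) //= mxE eqxx scale1r.
by rewrite big1 ?addr0 // => j ji; rewrite mxE eq_sym (negbTE ji) scale0r.
Qed.

Lemma homog_pull m n (E : 'M[R]_(m, n)) k a : homog k a -> homog k (pull E a).
Proof.
move: k a; apply: homog_dx_ind => [k c a b ha hb|k||k i a _ ha].
- by rewrite pullD pullZ; apply: homogD => //; exact: homogZ.
- by rewrite pull0; exact: homog0.
- by rewrite pull_ext1; exact: homog_ext1.
- by rewrite pull_dxl; exact: (homog_wedge (homog_cov E i) ha).
Qed.

Lemma pull_scale m n (E : 'M[R]_(m, n)) (s : R) k a :
  homog k a -> pull (s *: E) a = s ^+ k *: pull E a.
Proof.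
move: k a; apply: homog_dx_ind => [k c a b ha hb|k||k i a _ ha].
- by rewrite !(pullD, pullZ) ha hb scalerDr !scalerA [_ * c]mulrC.
- by rewrite !pull0 scaler0.
- by rewrite !pull_ext1 scale1r.
rewrite !pull_dxl ha wedgeZr exprSr -scalerA; congr (_ *: _); rewrite -wedgeZl; congr wedge.
by rewrite /cov scaler_sumr; apply: eq_bigr => j _; rewrite mxE scalerA.
Qed.

End Pull.

(** * Contraction with a vector *)

Section Contraction.
Variable R : realType.

(** Interior product with the i-th basis vector; the sign is the one that dx i acquires when it is
    multiplied in from the left. *)
Definition contract1 n (i : 'I_n) (a : ext R n) : ext R n :=
  [ffun S : {set 'I_n} =>
     if i \in S then 0 else shuffle_sign R [set i]%SET S * a (i |: S)%SET].

Definition contract n (v : 'cV[R]_n) (a : ext R n) : ext R n := \sum_i v i 0 *: contract1 i a.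

Lemma contract1_ebasis n (i : 'I_n) (T : {set 'I_n}) :
  contract1 i (ebasis R T) =
  if i \in T then shuffle_sign R [set i]%SET (T :\ i) *: ebasis R (T :\ i) else 0.
Proof.
apply/ffunP => S; rewrite !ffunE; case: ifP => iS.
  case: ifP => iT; rewrite !ffunE // (_ : S == _ = false) ?scaler0 //.
  by apply: contraTF iS => /eqP->; rewrite !finset.inE eqxx.
case: ifP => iT; rewrite !ffunE.
  have [->|ST] := eqVneq S (T :\ i); first by rewrite finset.setD1K // eqxx.
  rewrite (_ : _ == T = false) ?mulr0 ?scaler0 //; apply: contraNF ST => /eqP<-.
  by rewrite finset.setU1K // iS.
by rewrite (_ : _ == T = false) ?mulr0 //; apply: contraFF iT => /eqP<-; rewrite finset.setU11.
Qed.

Lemma contract1D n (i : 'I_n) a b : contract1 i (a + b) = contract1 i a + contract1 i b.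
Proof. by apply/ffunP => S; rewrite !ffunE; case: ifP; rewrite ?addr0 ?mulrDr. Qed.

Lemma contract1Z n (i : 'I_n) (k : R) a : contract1 i (k *: a) = k *: contract1 i a.
Proof.
by apply/ffunP => S; rewrite !ffunE; case: ifP; rewrite ?scaler0 // /GRing.scale /= mulrCA.
Qed.

(** The antiderivation rule for a left factor of degree one. Together with the value on 1 it
    determines contraction, and later arguments use only this recursion. *)
Lemma contract1_dx n (i j : 'I_n) a :
  contract1 i (wedge (dx R j) a) = (i == j)%:R *: a - wedge (dx R j) (contract1 i a).
Proof.
elim/ext_basis_ind: a => [k x y hx hy||T].
- rewrite wedgeDr wedgeZr !(contract1D, contract1Z) hx hy wedgeDr wedgeZr !scalerDr !scalerN.
  by rewrite !scalerA [_ * k]mulrC opprD [LHS]addrACA.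
- by have := contract1Z i 0 0; rewrite !(wedge0r, scale0r, scaler0) => ->; rewrite wedge0r subr0.
rewrite wedge_dx_ebasis contract1_ebasis; have [<-{j}|ij] := eqVneq i j.
  rewrite scale1r; case: ifP => iT.
    rewrite wedgeZr wedge_dx_ebasis !finset.inE eqxx /= scalerA shuffle_sign_sq scale1r.
    rewrite finset.setD1K // subrr.
    by have := contract1Z i 0 0; rewrite !scale0r.
  rewrite wedge0r subr0 contract1Z contract1_ebasis finset.setU11 finset.setU1K ?iT //.
  by rewrite scalerA shuffle_sign_sq scale1r.
rewrite scale0r sub0r; case: ifP => jT.
  have -> : contract1 i 0 = 0 :> ext R n by have := contract1Z i 0 0; rewrite !scale0r.
  case: ifP => iT; last by rewrite wedge0r oppr0.
  by rewrite wedgeZr wedge_dx_ebasis !finset.inE jT eq_sym ij /= scaler0 oppr0.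
rewrite contract1Z contract1_ebasis !finset.inE (negbTE ij) /=; case: ifP => iT; last first.
  by rewrite wedge0r scaler0 oppr0.
rewrite wedgeZr wedge_dx_ebasis !finset.inE jT andbF !scalerA -scaleNr.
have jTi : (j |: T) :\ i = j |: (T :\ i).
  by apply/setP => x; rewrite !finset.inE; case: eqP => //= ->; rewrite (negbTE ij).
rewrite jTi; congr (_ *: _).
have dj : [disjoint [set j]%SET & T :\ i] by rewrite disjoints1 !finset.inE jT andbF.
have di : [disjoint [set i]%SET & T :\ i] by rewrite disjoints1 !finset.inE eqxx.
rewrite (shuffle_signUr _ _ dj) -[in LHS](finset.setD1K iT) (shuffle_signUr _ _ di)
  !shuffle_sign11.
(* Inserting i and j in the two possible orders differs by one transposition: exactly one of j < i
   and i < j holds, which gives the minus sign of the rule. *)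
have -> : (-1) ^+ (j < i)%N = - (-1) ^+ (i < j)%N :> R.
  have : (i : nat) != j by rewrite (inj_eq val_inj).
  by case: ltngtP => //= _ _; rewrite expr0 expr1 ?opprK.
rewrite finset.setU1K ?finset.inE ?eqxx // !mulNr !mulrN; congr (- _).
by case: (i < j)%N; rewrite ?expr1 ?expr0; ring.
Qed.

Lemma contractD n (v : 'cV[R]_n) a b : contract v (a + b) = contract v a + contract v b.
Proof. by rewrite -big_split; apply: eq_bigr => i _; rewrite contract1D scalerDr. Qed.

Lemma contractZ n (v : 'cV[R]_n) (k : R) a : contract v (k *: a) = k *: contract v a.
Proof. by rewrite scaler_sumr; apply: eq_bigr => i _; rewrite contract1Z !scalerA mulrC. Qed.

Lemma contract0 n (v : 'cV[R]_n) : contract v 0 = 0.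
Proof. by have := contractZ v 0 0; rewrite !scale0r. Qed.

Lemma contract_sum n (v : 'cV[R]_n) (I : Type) (r : seq I) (P : pred I) F :
  contract v (\sum_(i <- r | P i) F i) = \sum_(i <- r | P i) contract v (F i).
Proof. by apply: (big_morph (contract v)) => [x y|]; rewrite ?contractD ?contract0. Qed.

Lemma contract_delta n (i : 'I_n) a : contract (delta_mx i 0) a = contract1 i a.
Proof.
rewrite /contract (bigD1 i) //= mxE !eqxx scale1r big1 ?addr0 // => j ji.
by rewrite mxE (negbTE ji) scale0r.
Qed.

Lemma contractZv n (v : 'cV[R]_n) (k : R) a : contract (k *: v) a = k *: contract v a.
Proof. by rewrite scaler_sumr; apply: eq_bigr => i _; rewrite mxE scalerA. Qed.

Lemma contract_dx n (v : 'cV[R]_n) j a :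
  contract v (wedge (dx R j) a) = v j 0 *: a - wedge (dx R j) (contract v a).
Proof.
rewrite /contract wedge_sumr -sumrN (eq_bigr (fun i => (v i 0 * (i == j)%:R) *: a
    - wedge (dx R j) (v i 0 *: contract1 i a))); last first.
  by move=> i _; rewrite contract1_dx scalerBr scalerA wedgeZr.
rewrite big_split /= -scaler_suml; congr (_ *: _ + _).
by rewrite (bigD1 j) //= eqxx mulr1 big1 ?addr0 // => i ij; rewrite (negbTE ij) mulr0.
Qed.

Lemma contract_ext1 n (v : 'cV[R]_n) : contract v ext1 = 0.
Proof.
by rewrite /contract big1 // => i _; rewrite ext1E contract1_ebasis finset.in_set0 scaler0.
Qed.

Lemma homog_contract n (v : 'cV[R]_n) k a : homog k.+1 a -> homog k (contract v a).
Proof.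
move=> ha; apply: homog_sum => i _; apply: homogZ => S Sk; rewrite ffunE.
by case: ifP => // iS; rewrite ha ?mulr0 // cardsU1 iS.
Qed.

Lemma contract_wedge n (v : 'cV[R]_n) k a b : homog k a ->
  contract v (wedge a b) = wedge (contract v a) b + (-1) ^+ k *: wedge a (contract v b).
Proof.
move=> ha; move: k a ha b; apply: homog_dx_ind => [k c x y hx hy b|k b|b|k i a _ IH b].
- rewrite !(wedgeDl, wedgeZl, contractD, contractZ) hx hy !scalerDr !scalerA.
  by rewrite [_ * c]mulrC addrACA.
- by rewrite !(wedge0l, contract0) scaler0 addr0.
- by rewrite contract_ext1 !wedge1l wedge0l add0r scale1r.
rewrite -wedgeA !contract_dx IH wedgeDl wedgeZl wedgeNl wedgeDr wedgeZr !wedgeA opprD addrA.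
by rewrite exprS mulN1r scaleNr.
Qed.

Lemma contract_cov m n (v : 'cV[R]_n) (E : 'M[R]_(m, n)) i a :
  contract v (wedge (cov E i) a) = (E *m v) i 0 *: a - wedge (cov E i) (contract v a).
Proof.
rewrite /cov !wedge_suml contract_sum mxE scaler_suml -sumrB; apply: eq_bigr => j _.
by rewrite wedgeZl contractZ contract_dx scalerBr wedgeZl scalerA.
Qed.

(** Both sides obey the same recursion on dx i /\ a, because the covector [cov E i] takes on v the
    value of the i-th coordinate of E v. *)
Lemma contract_pull m n (v : 'cV[R]_n) (E : 'M[R]_(m, n)) a :
  contract v (pull E a) = pull E (contract (E *m v) a).
Proof.
elim/ext_dx_ind: a => [k x y hx hy|||i a IH].
- by rewrite !(pullD, pullZ, contractD, contractZ) hx hy.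
- by rewrite !(contract0, pull0).
- by rewrite !pull_ext1 !contract_ext1 pull0.
- by rewrite pull_dxl contract_cov contract_dx pullD pullN pullZ pull_dxl IH.
Qed.

End Contraction.

(** * The Euclidean Hodge star *)

Section Hodge.
Variables (R : realType) (n : nat).
Implicit Types (a b : ext R n).

Definition vol : ext R n := ebasis R finset.setT.

Lemma hodgeD a b : std_hodge (a + b) = std_hodge a + std_hodge b.
Proof. by apply/ffunP => S; rewrite !ffunE mulrDr. Qed.

Lemma hodgeZ (k : R) a : std_hodge (k *: a) = k *: std_hodge a.
Proof. by apply/ffunP => S; rewrite !ffunE /GRing.scale /= mulrCA. Qed.

Lemma hodge0 : std_hodge 0 = 0 :> ext R n.
Proof. by have := hodgeZ 0 0; rewrite !scale0r. Qed.

Lemma hodge_ebasis (T : {set 'I_n}) :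
  std_hodge (ebasis R T) = shuffle_sign R T (~: T) *: ebasis R (~: T).
Proof.
apply/ffunP => S; rewrite !ffunE (can2_eq (@finset.setCK _) (@finset.setCK _)).
by have [->|_] := eqVneq; rewrite ?finset.setCK // mulr0 scaler0.
Qed.

Lemma hodge_ext1 : std_hodge ext1 = vol.
Proof. by rewrite ext1E hodge_ebasis shuffle_sign0l finset.setC0 scale1r. Qed.

Lemma homog_vol : homog n vol.
Proof. by have := @homog_ebasis R _ [set: 'I_n]%SET; rewrite finset.cardsT card_ord. Qed.

Lemma homog_hodge k p a : (k + p = n)%N -> homog k a -> homog p (std_hodge a).
Proof.
move=> kp ha S Sp; rewrite ffunE ha ?mulr0 //; apply: contra Sp => /eqP Sk.
by rewrite -(eqn_add2l k) kp -Sk addnC cardsC card_ord.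
Qed.

(** With C the complement of T, both signs expand to sg T {i} * sg {i} (C minus i) * sg T (C minus
    i). *)
Lemma hodge_wedge_dx a i : std_hodge (wedge a (dx R i)) = contract1 i (std_hodge a).
Proof.
elim/ext_basis_ind: a => [k x y hx hy||T].
- by rewrite !(wedgeDl, wedgeZl, hodgeD, hodgeZ, contract1D, contract1Z) hx hy.
- by rewrite wedge0l hodge0; have := contract1Z i 0 (0 : ext R n); rewrite !scale0r.
rewrite dxE wedge_ebasis hodge_ebasis contract1Z contract1_ebasis disjoint_sym disjoints1
  finset.inE.
case: ifP => iT; last by rewrite hodge0 scaler0.
have E : ~: (T :|: [set i]%SET) = ~: T :\ i by rewrite finset.setCU -finset.setDE.
rewrite hodgeZ hodge_ebasis !scalerA E; congr (_ *: _).
rewrite -[in RHS](@finset.setD1K _ i (~: T)) ?finset.inE ?iT //.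
rewrite finset.setU1K ?finset.inE ?eqxx //.
rewrite shuffle_signUl; last by rewrite disjoint_sym disjoints1.
rewrite shuffle_signUr; first by ring.
by rewrite disjoints1 !finset.inE eqxx.
Qed.

Lemma wedge_hodge_top a b : wedge a (std_hodge b) [set: 'I_n]%SET = \sum_S a S * b S.
Proof.
rewrite ffunE; apply: eq_big => [S|S _]; first by rewrite finset.subsetT.
by rewrite finset.setTD ffunE finset.setCK mulrACA shuffle_sign_sq mul1r.
Qed.

(** Symmetry of the Euclidean inner product; it moves the star from one factor to the other in the
    top-degree identities below. *)
Lemma wedge_hodge_topC a b :
  wedge a (std_hodge b) [set: 'I_n]%SET = wedge b (std_hodge a) [set: 'I_n]%SET.
Proof. by rewrite !wedge_hodge_top; apply: eq_bigr => S _; rewrite mulrC. Qed.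

Lemma homog_top a : homog n a -> a = a [set: 'I_n]%SET *: vol.
Proof.
move=> ha; apply/ffunP => S; rewrite !ffunE.
have [->|ST] := eqVneq; first by rewrite /GRing.scale /= mulr1.
rewrite scaler0 ha //; apply: contra ST => /eqP Sn.
by rewrite eqEcard finset.subsetT finset.cardsT card_ord Sn leqnn.
Qed.

(** As k < n, every S of size k misses some i, and up to sign the coefficient of [i |: S] in dx i /\
    a is [a S]. *)
Lemma wedge_dx_eq0 k a : homog k a -> (k < n)%N ->
  (forall i, wedge (dx R i) a = 0) -> a = 0.
Proof.
move=> ha kn h; apply/ffunP => S; rewrite [RHS]ffunE.
have [Sk|/ha//] := eqVneq #|S| k.
have [i iS] : exists i, i \notin S.
  apply/existsP; rewrite -negb_forall; apply: contraTN kn => /forallP aS.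
  by rewrite -leqNgt -Sk -[leqLHS]card_ord -finset.cardsT subset_leq_card //;
    apply/fintype.subsetP.
have /(congr1 (fun a : ext R n => a (i |: S)%SET)) := h i.
rewrite !ffunE (bigD1 [set i]%SET) ?finset.sub1set ?finset.setU11 //= big1 ?addr0.
  rewrite !ffunE eqxx mulr1 finset.setU1K // => /(congr1 (fun x =>
    shuffle_sign R [set i]%SET S * x)).
  by rewrite mulr0 mulrA shuffle_sign_sq mul1r.
by move=> T /andP[_ Ti]; rewrite !ffunE (negbTE Ti) mulr0 mul0r.
Qed.

(* The Hodge star turns right multiplication by a covector into contraction, and
   contraction is natural under pullback, so the factor s is picked up once per
   degree. *)
Lemma hodge_conformal (A : 'M[R]_n) (s c : R) k a :
  A *m A^T = s%:M -> pull A vol = c *: vol -> homog k a ->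
  c *: std_hodge (pull A a) = s ^+ k *: pull A (std_hodge a).
Proof.
move=> As Ac; move: k a; apply: homog_dx_indr => [k x a b ha hb|k||k i a _ IH].
- rewrite !(pullD, pullZ, hodgeD, hodgeZ, scalerDr) -hb.
  by rewrite scalerA mulrC -scalerA ha !scalerA [x * _]mulrC.
- by rewrite !(pull0, hodge0) !scaler0.
- by rewrite pull_ext1 hodge_ext1 scale1r.
(* The pullback of dx i is the i-th row of A, so the star turns it into contraction with A^T e_i.
   Passing through [pull A] this becomes contraction with A A^T e_i = s e_i. *)
have -> : c *: std_hodge (pull A (wedge a (dx R i))) =
    contract (A^T *m delta_mx i 0) (c *: std_hodge (pull A a)).
  rewrite pull_wedge pull_dx /cov wedge_sumr /contract.
  rewrite (big_morph _ hodgeD hodge0) scaler_sumr; apply: eq_bigr => j _.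
  rewrite wedgeZr hodgeZ hodge_wedge_dx contract1Z !scalerA [c * _]mulrC; congr (_ * _ *: _).
  rewrite mxE (bigD1 i) //= !mxE !eqxx mulr1 big1 ?addr0 // => l li.
  by rewrite !mxE (negbTE li) mulr0.
rewrite IH contractZ contract_pull mulmxA As mul_scalar_mx contractZv pullZ
  contract_delta hodge_wedge_dx.
by rewrite scalerA exprSr.
Qed.

End Hodge.

(** * Computation with integral forms *)

Section Reflection.

(* An integral combination of the monomials [mono]; indices start at 1 and the
   lists of indices need not be sorted. *)
Definition rpoly := seq (int * seq nat).

Definition rmul (p q : rpoly) : rpoly :=
  [seq (a.1 * b.1, a.2 ++ b.2) | a <- p, b <- q].

Definition rscale (c : int) (p : rpoly) : rpoly := [seq (c * a.1, a.2) | a <- p].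

(** The boolean is the parity of the transpositions made; [None] records a repeated index, that is,
    a vanishing monomial. *)
Fixpoint rins (i : nat) (s : seq nat) : option (bool * seq nat) :=
  if s is j :: s' then
    if (i < j)%N then Some (false, i :: s)
    else if i == j then None
    else omap (fun x => (~~ x.1, j :: x.2)) (rins i s')
  else Some (false, [:: i]).

Definition rsort (s : seq nat) : option (bool * seq nat) :=
  foldr (fun i r => if r is Some (b, t) then
    omap (fun x => (b (+) x.1, x.2)) (rins i t) else None) (Some (false, [::])) s.

Fixpoint radd (c : int) (s : seq nat) (p : rpoly) : rpoly :=
  if p is a :: p' then
    if a.2 == s then (c + a.1, s) :: p' else a :: radd c s p'
  else [:: (c, s)].

Definition rnorm (p : rpoly) : rpoly :=
  foldr (fun a q => if rsort a.2 is Some (b, t)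
                    then radd (if b then - a.1 else a.1) t q else q) [::] p.

Definition rzero (p : rpoly) : bool := all (fun a => a.1 == 0) (rnorm p).

Definition req (p q : rpoly) : bool := rzero (p ++ rscale (-1) q).

Variable n : nat.

(* [inord k] is [0] when k is out of range. *)
Definition ridx (i : nat) : nat := if (i.-1 < n.+1)%N then i.-1 else 0.

Fixpoint rctr_mono (i : nat) (s : seq nat) : rpoly :=
  if s is j :: s' then
    (if ridx i == ridx j then [:: (1, s')] else [::])
      ++ [seq (- a.1, j :: a.2) | a <- rctr_mono i s']
  else [::].

Definition rctr (i : nat) (p : rpoly) : rpoly :=
  flatten [seq rscale a.1 (rctr_mono i a.2) | a <- p].

Definition rvol : rpoly := [:: (1, iota 1 n.+1)].

(** Iterates the rule that the star of a /\ dx i is the i-th contraction of the star of a, starting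
    from vol, the star of 1. Complements and shuffle signs never have to be computed. *)
Definition rhodge (p : rpoly) : rpoly :=
  flatten [seq rscale a.1 (foldl (fun q i => rctr i q) rvol a.2) | a <- p].

Variable R : realType.

Definition rpoly_val (p : rpoly) : ext R n.+1 := \sum_(a <- p) (a.1)%:~R *: mono R n a.2.

Local Notation ev := rpoly_val.
Local Notation dxi i := (dx R (inord i.-1 : 'I_n.+1)).

Lemma ev_cat p q : ev (p ++ q) = ev p + ev q.
Proof. by rewrite /ev big_cat. Qed.

Lemma ev_cons a p : ev (a :: p) = (a.1)%:~R *: mono R n a.2 + ev p.
Proof. by rewrite /ev big_cons. Qed.

Lemma ev_nil : ev [::] = 0.
Proof. by rewrite /ev big_nil. Qed.

Lemma ev1 s : ev [:: (1, s)] = mono R n s.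
Proof. by rewrite ev_cons ev_nil addr0 scale1r. Qed.

Lemma ev_scale c p : ev (rscale c p) = c%:~R *: ev p.
Proof.
rewrite /ev big_map scaler_sumr; apply: eq_bigr => a _ /=.
by rewrite scalerA intrM.
Qed.

Lemma ev_flatten (T : Type) (F : T -> rpoly) (r : seq T) :
  ev (flatten [seq F a | a <- r]) = \sum_(a <- r) ev (F a).
Proof.
elim: r => [|a r IH] /=; first by rewrite ev_nil big_nil.
by rewrite ev_cat IH big_cons.
Qed.

Lemma mono_cat s t : mono R n (s ++ t) = wedge (mono R n s) (mono R n t).
Proof.
elim: s => [|i s IH] /=; first by rewrite wedge1l.
by rewrite IH wedgeA.
Qed.

Lemma ev_mul p q : ev (rmul p q) = wedge (ev p) (ev q).
Proof.
rewrite /ev /rmul big_allpairs_dep wedge_suml; apply: eq_bigr => a _.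
rewrite wedge_sumr; apply: eq_bigr => b _ /=.
by rewrite mono_cat intrM wedgeZl wedgeZr scalerA.
Qed.

Lemma rinsP i s : wedge (dxi i) (mono R n s) =
  if rins i s is Some (b, t) then (-1 : R) ^+ b *: mono R n t else 0.
Proof.
elim: s => [|j s IH] /=; first by rewrite scale1r.
case: ifP => _ /=; first by rewrite scale1r.
case: eqP => [<-|_]; first by rewrite wedgeA wedge_dx_sq wedge0l.
rewrite wedgeA wedge_dx_anti wedgeNl -wedgeA IH.
case: (rins i s) => [[b t]|] /=; last by rewrite wedge0r oppr0.
by rewrite wedgeZr -scaleNr signrN.
Qed.

Lemma rsortP s : mono R n s =
  if rsort s is Some (b, t) then (-1 : R) ^+ b *: mono R n t else 0.
Proof.
elim: s => [|i s /= ->] /=; first by rewrite scale1r.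
case: (rsort s) => [[b t]|]; last by rewrite wedge0r.
rewrite wedgeZr rinsP; case: (rins i t) => [[c u]|] /=; last by rewrite scaler0.
by rewrite scalerA signr_addb.
Qed.

Lemma ev_add c s p : ev (radd c s p) = c%:~R *: mono R n s + ev p.
Proof.
elim: p => [|a p IH] /=; first by rewrite ev_cons.
case: eqP => [<-|_]; rewrite !ev_cons /=; first by rewrite intrD scalerDl addrA.
by rewrite IH addrCA.
Qed.

Lemma ev_norm p : ev (rnorm p) = ev p.
Proof.
elim: p => //= a p IH; rewrite ev_cons [mono _ _ a.2]rsortP.
case: (rsort a.2) => [[b t]|]; last by rewrite scaler0 add0r.
by rewrite ev_add IH scalerA; case: b; rewrite ?mulr1 // mulrN1 intrN.
Qed.

Lemma rzeroP p : rzero p -> ev p = 0.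
Proof.
rewrite -(ev_norm p) /rzero; elim: (rnorm p) => [|a q IH] /=; first by rewrite ev_nil.
by case/andP => /eqP a0 /IH qz; rewrite ev_cons a0 scale0r add0r.
Qed.

(** Reduces an identity between forms to a boolean for [vm_compute]. The coefficients are integers,
    so the computation does not involve [R]. *)
Lemma reqP p q : req p q -> ev p = ev q.
Proof. by move/rzeroP/eqP; rewrite ev_cat ev_scale scaleN1r subr_eq0 => /eqP. Qed.

Lemma ev_contract i p : contract1 (inord i.-1) (ev p) = ev (rctr i p).
Proof.
have contract10 j : contract1 j 0 = 0 :> ext R n.+1 by rewrite -contract_delta contract0.
have mono_contract s : contract1 (inord i.-1) (mono R n s) = ev (rctr_mono i s).
  elim: s => [|j s IH] /=.
    by rewrite ev_nil -contract_delta contract_ext1.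
  rewrite ev_cat contract1_dx IH; congr (_ + _).
    have -> : (inord i.-1 == inord j.-1 :> 'I_n.+1) = (ridx i == ridx j).
      by rewrite -(inj_eq val_inj) /inord !val_insubd.
    by case: eqP => _; rewrite ?ev_nil ?scale0r // ev1 scale1r.
  rewrite /ev big_map wedge_sumr -sumrN; apply: eq_bigr => a _ /=.
  by rewrite wedgeZr intrN scaleNr.
rewrite /rctr ev_flatten /ev (big_morph _ (@contract1D R n.+1 _) (contract10 _)).
by apply: eq_bigr => a _; rewrite -/(ev _) ev_scale contract1Z mono_contract.
Qed.

Lemma mono_blade s : mono R n s = blade (@dx R n.+1) [seq inord i.-1 | i <- s].
Proof. by elim: s => //= i s ->. Qed.

Lemma ev_vol : ev rvol = vol R n.+1.
Proof.
rewrite ev1 mono_blade /vol ebasis_blade; congr blade; apply: (inj_map val_inj).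
rewrite -map_comp enum_setT -enumT val_enum_ord (iotaDl 1 0) -map_comp.
rewrite -[RHS]map_id; apply/eq_in_map => k; rewrite mem_iota /= => kn; rewrite /= add0n inordK //.
Qed.

Lemma ev_hodge p : std_hodge (ev p) = ev (rhodge p).
Proof.
(* Generalised over the prefix [a] already absorbed and over its star [q], which is the accumulator
   of the left fold. *)
have mono_hodge s a q : std_hodge a = ev q ->
    std_hodge (wedge a (mono R n s)) = ev (foldl (fun q i => rctr i q) q s).
  elim: s a q => [|i s IH] a q aq /=; first by rewrite wedge1r.
  by rewrite wedgeA; apply: IH; rewrite hodge_wedge_dx aq ev_contract.
rewrite /rhodge ev_flatten /ev (big_morph _ (@hodgeD R n.+1) (@hodge0 R n.+1)).
apply: eq_bigr => a _; rewrite -/(ev _) ev_scale hodgeZ -[mono _ _ _]wedge1l.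
by rewrite (mono_hodge _ _ rvol) // ev_vol hodge_ext1.
Qed.

End Reflection.

Definition rg2 : rpoly :=
  [:: (1, [:: 1; 2; 7]%N); (1, [:: 3; 4; 7]%N); (1, [:: 5; 6; 7]%N); (1, [:: 1; 3; 5]%N);
      (-1, [:: 1; 4; 6]%N); (-1, [:: 2; 3; 6]%N); (-1, [:: 2; 4; 5]%N)].

(** The dual 4-form of [rg2] written out. It is also the part of the Spin(7) model free of e^8, so
    that this model is phi0 /\ e^8 + psi0. *)
Definition rg2s : rpoly :=
  [:: (1, [:: 1; 2; 3; 4]%N); (1, [:: 1; 2; 5; 6]%N); (1, [:: 3; 4; 5; 6]%N);
      (1, [:: 1; 3; 6; 7]%N); (1, [:: 1; 4; 5; 7]%N); (1, [:: 2; 3; 5; 7]%N);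
      (-1, [:: 2; 4; 6; 7]%N)].

Definition rspin7 : rpoly := rmul rg2 [:: (1, [:: 8]%N)] ++ rg2s.

(** Lets [vm_compute] decide a family of identities indexed by ordinals; monomials count indices
    from 1, hence the shift. *)
Lemma forall_ord_iota n (P : nat -> bool) : all P (iota 1 n.+1) -> forall i : 'I_n.+1, P i.+1.
Proof. by move/allP => h i; apply: h; rewrite mem_iota /= add1n ltnS ltn_ord. Qed.

(** * The G_2 and Spin(7) models *)

Section Models.
Variable R : realType.
Local Notation phi0 := (@g2_model R).
Local Notation psi0 := (std_hodge (@g2_model R)).
Local Notation Phi0 := (@spin7_model R).

Lemma ev_pair1 n s p : rpoly_val n R ((1, s) :: p) = mono R n s + rpoly_val n R p.
Proof. by rewrite ev_cons scale1r. Qed.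

Lemma ev_pairN1 n s p : rpoly_val n R ((-1, s) :: p) = - mono R n s + rpoly_val n R p.
Proof. by rewrite ev_cons intrN scaleN1r. Qed.

Lemma ev_singleN1 n s : rpoly_val n R [:: (-1, s)] = - mono R n s.
Proof. by rewrite ev_pairN1 ev_nil addr0. Qed.

Lemma g2_ev : phi0 = rpoly_val 6 R rg2.
Proof.
rewrite /rg2; do 4 rewrite ev_pair1; do 2 rewrite ev_pairN1; rewrite ev_singleN1.
by rewrite /g2_model -!addrA.
Qed.

Lemma g2_star_ev : psi0 = rpoly_val 6 R rg2s.
Proof. by rewrite g2_ev ev_hodge; apply: reqP; vm_compute. Qed.

Lemma spin7_ev : Phi0 = rpoly_val 7 R rspin7.
Proof.
have -> : rspin7 = [seq (a.1, rcons a.2 8) | a <- rg2] ++ rg2s by vm_compute.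
rewrite /rg2 /rg2s [map _ _]/= /cat.
do 4 rewrite ev_pair1; do 3 rewrite ev_pairN1.
do 6 rewrite ev_pair1; rewrite ev_singleN1.
by rewrite /spin7_model -!addrA.
Qed.

Lemma homog_mono n s : homog (size s) (mono R n s).
Proof.
elim: s => [|i s IH] /=; first exact: homog_ext1.
exact: (homog_wedge (homog_dx R _) IH).
Qed.

Lemma homog_ev n k p : all (fun a => size a.2 == k) p -> homog k (rpoly_val n R p).
Proof.
rewrite /rpoly_val big_seq => /allP h; apply: homog_sum => a /h /eqP <-.
by apply: homogZ; exact: homog_mono.
Qed.

Lemma homog_g2 : homog 3 phi0.
Proof. by rewrite g2_ev; exact: homog_ev. Qed.

Lemma homog_g2_star : homog 4 psi0.
Proof. exact: (homog_hodge _ homog_g2). Qed.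

Lemma homog_spin7 : homog 4 Phi0.
Proof. by rewrite spin7_ev; exact: homog_ev. Qed.

Lemma spin7_selfdual : std_hodge Phi0 = Phi0.
Proof. by rewrite spin7_ev ev_hodge; apply: reqP; vm_compute. Qed.

(** By self-duality the left side is |Phi0|^2 vol, and the model has 14 monomials with coefficients
    1 or -1. *)
Lemma spin7_sq : wedge Phi0 Phi0 = 14%:R *: vol R 8.
Proof.
rewrite spin7_ev -ev_mul -ev_vol [14%:R](_ : _ = 14%:~R) // -ev_scale.
by apply: reqP; vm_compute.
Qed.

Lemma dx_ev n (i : 'I_n.+1) : dx R i = rpoly_val n R [:: (1, [:: i.+1])].
Proof. by rewrite ev1 /= wedge1r inord_val. Qed.

Lemma contract1_ev n (i : 'I_n.+1) p : contract1 i (rpoly_val n R p) =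
  rpoly_val n R (rctr n i.+1 p).
Proof. by rewrite -ev_contract /= inord_val. Qed.

Lemma g2_contract1_sq (i : 'I_7) :
  wedge (contract1 i phi0) phi0 = 2%:R *: wedge (dx R i) psi0.
Proof.
rewrite g2_star_ev g2_ev contract1_ev dx_ev -!ev_mul [2%:R](_ : _ = 2%:~R) // -ev_scale.
apply: reqP; move: i; apply: (@forall_ord_iota 6 (fun k => req
  (rmul (rctr 6 k rg2) rg2) (rscale 2%:Z (rmul [:: (1, [:: k])] rg2s)))).
by vm_compute.
Qed.

(** The constant 3 here and the 4 of the next identity count the monomials of phi0 and of psi0 that
    contain a given index. They add up to 7, in accordance with phi0 /\ psi0 = 7 vol. *)
Lemma g2_contract1_star (i : 'I_7) : wedge (contract1 i phi0) psi0 =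
  3%:R *: contract1 i (vol R 7).
Proof.
rewrite g2_star_ev g2_ev -ev_vol !contract1_ev -!ev_mul [3%:R](_ : _ = 3%:~R) // -ev_scale.
apply: reqP; move: i; apply: (@forall_ord_iota 6 (fun k => req
  (rmul (rctr 6 k rg2) rg2s) (rscale 3%:Z (rctr 6 k (rvol 6))))).
by vm_compute.
Qed.

Lemma g2_star_contract1 (i : 'I_7) : wedge (contract1 i psi0) phi0 =
  4%:R *: contract1 i (vol R 7).
Proof.
rewrite g2_star_ev g2_ev -ev_vol !contract1_ev -!ev_mul [4%:R](_ : _ = 4%:~R) // -ev_scale.
apply: reqP; move: i; apply: (@forall_ord_iota 6 (fun k => req
  (rmul (rctr 6 k rg2s) rg2) (rscale 4%:Z (rctr 6 k (rvol 6))))).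
by vm_compute.
Qed.

Lemma g2_hodge_contract1 (i : 'I_7) : std_hodge (contract1 i psi0) = wedge phi0 (dx R i).
Proof.
rewrite g2_star_ev g2_ev dx_ev !contract1_ev ev_hodge -!ev_mul.
apply: reqP; move: i; apply: (@forall_ord_iota 6 (fun k => req
  (rhodge 6 (rctr 6 k rg2s)) (rmul rg2 [:: (1, [:: k])]))).
by vm_compute.
Qed.

(** The classical formula by which a G_2 3-form determines its metric and volume form, checked on
    the 49 pairs of basis vectors. *)
Lemma g2_metric1 (i j : 'I_7) :
  wedge (wedge (contract1 i phi0) (contract1 j phi0)) phi0 = (6%:R * (i == j)%:R) *: vol R 7.
Proof.
rewrite g2_ev -ev_vol !contract1_ev -!ev_mul.
have -> : 6%:R * (i == j)%:R = (6%:Z * (i.+1 == j.+1 :> nat)%:Z)%:~R :> R.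
  by rewrite intrM eqSS (inj_eq val_inj).
rewrite -ev_scale; apply: reqP.
have h : all (fun k => all (fun l => req
    (rmul (rmul (rctr 6 k rg2) (rctr 6 l rg2)) rg2)
    (rscale (6%:Z * (k == l)%:Z) (rvol 6))) (iota 1 7)) (iota 1 7) by vm_compute.
exact: (forall_ord_iota (forall_ord_iota h i) j).
Qed.

Lemma g2_metric (u v : 'cV[R]_7) :
  wedge (wedge (contract u phi0) (contract v phi0)) phi0 = (6%:R * (u^T *m v) 0 0) *: vol R 7.
Proof.
rewrite /contract !wedge_suml mxE mulr_sumr scaler_suml; apply: eq_bigr => i _.
rewrite wedge_sumr wedge_suml (bigD1 i) //= big1 ?addr0 => [|j ji].
  by rewrite !(wedgeZl, wedgeZr) g2_metric1 eqxx !scalerA mxE; congr (_ *: _);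
    rewrite mulr1; ring.
by rewrite !(wedgeZl, wedgeZr) g2_metric1 eq_sym (negbTE ji) mulr0 scale0r !scaler0.
Qed.

Lemma scale_vol_inj n (x y : R) : x *: vol R n = y *: vol R n -> x = y.
Proof.
move/(congr1 (fun a : ext R n => a [set: 'I_n]%SET)).
by rewrite !ffunE eqxx /GRing.scale /= !mulr1.
Qed.

(* G_2 lies in SO(7): if A pulls vol back to c vol, then
   (i_u phi) /\ (i_v phi) /\ phi = 6 <u, v> vol gives c A^T A = 1, and comparing
   the stars of both sides of pull A vol = c vol gives c ^ 9 = 1. *)
Lemma g2_stabilizer (A : 'M[R]_7) : pull A phi0 = phi0 ->
  A *m A^T = 1%:M /\ pull A (vol R 7) = vol R 7.
Proof.
move=> Aphi; set c := pull A (vol R 7) [set: 'I_7]%SET.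
have Ac : pull A (vol R 7) = c *: vol R 7.
  by rewrite /c -homog_top //; apply: homog_pull; exact: homog_vol.
have AA : (c *: A^T) *m A = 1%:M.
  apply/matrixP => i j.
  have dE (B : 'M[R]_7) : ((delta_mx i 0)^T *m (B *m delta_mx j 0) : 'M[R]_1) 0 0 = B i j.
    by rewrite trmx_delta mulmxA -rowE -colE !mxE.
  have := g2_metric (delta_mx i 0) (delta_mx j 0).
  rewrite -[in LHS]Aphi !contract_pull -!pull_wedge g2_metric pullZ Ac scalerA.
  move/scale_vol_inj; rewrite -mulrA => /mulfI H.
  have {H} := H _; rewrite pnatr_eq0 => /(_ isT).
  rewrite trmx_mul -mulmxA [A^T *m _]mulmxA dE -[delta_mx j 0]mul1mx dE => <-.
  by rewrite -scalemxAl [LHS]mxE mulrC.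
have c0 : c != 0.
  apply/negP => /eqP c0; move: AA; rewrite c0 scale0r mul0mx => /matrixP/(_ 0 0).
  by rewrite !mxE eqxx => /esym/eqP; rewrite oner_eq0.
have As : A *m A^T = (c^-1)%:M.
  have := mulmx1C AA; rewrite -scalemxAr => /(congr1 (GRing.scale c^-1)).
  by rewrite scalerA mulVf // scale1r scalemx1.
(* With A A^T = c^-1, the conformal rule in degree 7 reads c^2 = c^-7. As 9 is odd, c = 1 is the
   only real solution. *)
have c9 : c ^+ 9 = 1.
  have := hodge_conformal As Ac (@homog_vol R 7).
  have -> : std_hodge (vol R 7) = ext1.
    by rewrite hodge_ebasis finset.setCT shuffle_sign0r scale1r.
  rewrite Ac hodgeZ hodge_ebasis finset.setCT shuffle_sign0r scale1r pull_ext1 scalerA.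
  move/(congr1 (fun a : ext R 7 => a finset.set0)).
  rewrite !ffunE eqxx /GRing.scale /= !mulr1 => /(congr1 (fun x => x * c ^+ 7)).
  rewrite -exprMn mulVf // expr1n => <-; ring.
have c1 : c = 1.
  have [cp|cn] := leP 0 c; first by apply/eqP; rewrite -(pexpr_eq1 (n := 9)) // c9.
  have : c * (c ^+ 4) ^+ 2 <= 0 by rewrite mulr_le0_ge0 ?sqr_ge0 // ltW.
  by rewrite -exprM -exprS c9 ler10.
by rewrite As Ac c1 invr1 scale1r.
Qed.

Lemma g2_hodge_pull (A : 'M[R]_7) k a : pull A phi0 = phi0 -> homog k a ->
  std_hodge (pull A a) = pull A (std_hodge a).
Proof.
move=> /g2_stabilizer[AA Av] ha.
have := @hodge_conformal _ _ A 1 1 k a AA.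
by rewrite Av scale1r expr1n !scale1r => /(_ erefl ha).
Qed.

Lemma contract_dx1 n (v : 'cV[R]_n) j : contract v (dx R j) = v j 0 *: ext1.
Proof. by rewrite -[dx R j]wedge1r contract_dx contract_ext1 wedge0r subr0. Qed.

(* Self-duality of the model turns contraction of [Phi0] into the star of
   [wedge Phi0 (dx i)]; the right-hand side does not involve the metric, so that
   the stabilizer of [Phi0] is not needed. *)
Lemma spin7_48P (c : ext R 8) : homog 5 c ->
  wedge Phi0 (std_hodge c) = 0 <-> forall v, wedge (contract v Phi0) c = 0.
Proof.
move=> hc.
have hs : homog 3 (std_hodge c) by exact: (homog_hodge _ hc).
have hw : homog 7 (wedge Phi0 (std_hodge c)) by exact: (homog_wedge homog_spin7 hs).
(* Symmetry of the inner product moves the star from c onto dx i /\ Phi0. The minus sign comes from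
   exchanging factors of degrees 5 and 3. *)
have top_part i : wedge (dx R i) (wedge Phi0 (std_hodge c)) = - wedge (contract1 i Phi0) c.
  have h8 : homog 8 (wedge (dx R i) (wedge Phi0 (std_hodge c))).
    exact: (homog_wedge (homog_dx R i) hw).
  have h3 : homog 3 (contract1 i Phi0).
    by rewrite -contract_delta; apply: homog_contract; exact: homog_spin7.
  have h3c : homog 8 (wedge (contract1 i Phi0) c) by exact: (homog_wedge h3 hc).
  rewrite (homog_top h8) (homog_top h3c) -scaleNr; congr (_ *: _).
  rewrite wedgeA wedge_hodge_topC (wedgeC (homog_dx R i) homog_spin7) hodgeZ.
  rewrite hodge_wedge_dx spin7_selfdual wedgeZr (wedgeC hc h3) !scalerA ffunE.
  by rewrite -exprD -signr_odd /= expr1 /GRing.scale /= mulN1r.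
split=> [h v|h].
  rewrite /contract wedge_suml big1 // => i _.
  by rewrite wedgeZl -[wedge _ _]opprK -top_part h wedge0r oppr0 scaler0.
apply: wedge_dx_eq0 hw _ _ => // i.
by rewrite top_part -contract_delta h oppr0.
Qed.

(** Contract the (n+1)-form a /\ vol, which is zero. *)
Lemma wedge_contract_vol n (v : 'cV[R]_n) (a : ext R n) : homog 1 a ->
  wedge a (contract v (vol R n)) = wedge (contract v a) (vol R n).
Proof.
move=> ha; have h : homog n.+1 (wedge a (vol R n)).
  exact: (homog_wedge ha (@homog_vol R n)).
have := contract_wedge v (vol R n) ha.
rewrite (homog_gt (ltnSn n) h) contract0 expr1 scaleN1r => /esym/eqP.
by rewrite subr_eq0 => /eqP.
Qed.

Lemma wedge_contract_vol_inj n (a : ext R n) : homog 1 a ->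
  (forall v : 'cV[R]_n, wedge a (contract v (vol R n)) = 0) -> a = 0.
Proof.
move=> ha h; apply/ffunP => S; rewrite [RHS]ffunE.
have [/eqP/cards1P[i ->]|/ha//] := eqVneq #|S| 1%N.
have := h (delta_mx i 0); rewrite wedge_contract_vol // contract_delta.
have -> : contract1 i a = a [set i]%SET *: ext1.
  apply/ffunP => T; rewrite !ffunE; have [->|T0] := eqVneq T finset.set0.
    by rewrite finset.in_set0 shuffle_sign0r mul1r finset.setU0 /GRing.scale /= mulr1.
  rewrite scaler0; case: ifP => // iT; rewrite ha ?mulr0 // cardsU1 iT add1n eqSS.
  by rewrite cards_eq0.
rewrite wedgeZl wedge1l => /(congr1 (fun a : ext R n => a [set: 'I_n]%SET)).
by rewrite !ffunE eqxx /GRing.scale /= mulr1.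
Qed.

Lemma spin7_wedge_inj (a : ext R 8) : homog 1 a ->
  (forall v, wedge (contract v Phi0) (wedge a Phi0) = 0) -> a = 0.
Proof.
move=> ha h; apply: wedge_contract_vol_inj => // v.
have h3 : homog 3 (contract v Phi0) by apply: homog_contract; exact: homog_spin7.
(* The two Leibniz terms agree because Phi0 has even degree. *)
have : contract v (wedge Phi0 Phi0) = 2%:R *: wedge (contract v Phi0) Phi0.
  rewrite (contract_wedge _ _ homog_spin7) (wedgeC homog_spin7 h3) scalerA -exprD.
  by rewrite -signr_odd /= expr0 scale1r scaler_nat mulr2n.
rewrite spin7_sq contractZ => /(congr1 (wedge a)); rewrite !wedgeZr.
have -> : wedge a (wedge (contract v Phi0) Phi0) = 0.
  by rewrite wedgeA (wedgeC ha h3) wedgeZl -wedgeA h scaler0.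
by rewrite scaler0 => /eqP; rewrite scaler_eq0 pnatr_eq0 => /eqP.
Qed.

Lemma g2_contract_sq (u : 'cV[R]_7) : wedge (contract u phi0) phi0 =
  2%:R *: wedge (\sum_i u i 0 *: dx R i) psi0.
Proof.
rewrite /contract !wedge_suml scaler_sumr; apply: eq_bigr => i _.
by rewrite !wedgeZl g2_contract1_sq !scalerA mulrC.
Qed.

Lemma g2_contract_star (u : 'cV[R]_7) :
  wedge (contract u phi0) psi0 = 3%:R *: contract u (vol R 7).
Proof.
rewrite /contract !wedge_suml scaler_sumr; apply: eq_bigr => i _.
by rewrite !wedgeZl g2_contract1_star !scalerA mulrC.
Qed.

Lemma g2_star_contract (u : 'cV[R]_7) :
  wedge (contract u psi0) phi0 = 4%:R *: contract u (vol R 7).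
Proof.
rewrite /contract !wedge_suml scaler_sumr; apply: eq_bigr => i _.
by rewrite !wedgeZl g2_star_contract1 !scalerA mulrC.
Qed.

Section Warped.
Variables (t1 t2 t3 : ext R 7).
Hypotheses (h1 : homog 1 t1) (h2 : homog 2 t2) (h3 : homog 3 t3).
Hypotheses (t2psi : wedge t2 psi0 = 0) (t3phi : wedge t3 phi0 = 0)
  (t3psi : wedge t3 psi0 = 0).

Lemma g2_sq : wedge phi0 phi0 = 0.
Proof.
have /eqP := wedgeC homog_g2 homog_g2; rewrite -signr_odd /= expr1 scaleN1r.
by rewrite -subr_eq0 opprK -mulr2n -scaler_nat scaler_eq0 pnatr_eq0 => /eqP.
Qed.

Lemma homog_star_t3 : homog 4 (std_hodge t3).
Proof. exact: (homog_hodge _ h3). Qed.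

(** The left side is the inner product of phi0 and t3, and so is t3 /\ psi0. *)
Lemma wedge_g2_star_t3 : wedge phi0 (std_hodge t3) = 0.
Proof.
have h : homog 7 (wedge phi0 (std_hodge t3)).
  exact: (homog_wedge homog_g2 homog_star_t3).
by rewrite (homog_top h) wedge_hodge_topC t3psi ffunE scale0r.
Qed.

Variable w : 'cV[R]_7.

Let hp : homog 2 (contract w phi0). Proof. by apply: homog_contract; exact: homog_g2. Qed.
Let hq : homog 3 (contract w psi0). Proof. by apply: homog_contract; exact: homog_g2_star. Qed.

(** Since i_w phi0 /\ phi0 is a multiple of a covector wedged with psi0, the product contains t2 /\
    psi0. *)
Lemma wedge_contract_t2 : wedge (contract w phi0) (wedge t2 phi0) = 0.
Proof.
rewrite wedgeA (wedgeC hp h2) wedgeZl -wedgeA g2_contract_sq wedgeZr wedgeA.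
have hf : homog 1 (\sum_i w i 0 *: dx R i : ext R 7).
  by apply: homog_sum => i _; apply: homogZ; exact: homog_dx.
by rewrite (wedgeC h2 hf) wedgeZl -wedgeA t2psi wedge0r !scaler0.
Qed.

(** This is the inner product of i_w psi0 with t3. The star of i_w psi0 is phi0 wedged with a
    covector, so t3 /\ phi0 appears. *)
Lemma wedge_contract_star_t3 : wedge (contract w psi0) (std_hodge t3) = 0.
Proof.
have h : homog 7 (wedge (contract w psi0) (std_hodge t3)).
  exact: (homog_wedge hq homog_star_t3).
rewrite (homog_top h) wedge_hodge_topC /contract.
rewrite (big_morph _ (@hodgeD R 7) (@hodge0 R 7)) wedge_sumr big1 ?ffunE ?scale0r // => i _.
by rewrite hodgeZ wedgeZr g2_hodge_contract1 wedgeA t3phi wedge0l scaler0.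
Qed.

(** Both products are multiples of t1 /\ i_w vol, with constants 4 and 3. The sign arises because t1
    passes a 3-form on the left and a 2-form on the right. *)
Lemma wedge_contract_t1 : wedge (contract w psi0) (wedge t1 phi0) =
  - (4%:R / 3%:R) *: wedge (contract w phi0) (wedge t1 psi0).
Proof.
rewrite !wedgeA (wedgeC hp h1) (wedgeC hq h1) !wedgeZl -!wedgeA.
rewrite g2_contract_star g2_star_contract !wedgeZr !scalerA; congr (_ *: _).
rewrite -signr_odd /= expr1 -signr_odd /= expr0.
by field.
Qed.

End Warped.

End Models.

(** * Linear algebra at a point of the cylinder *)

Section Pointwise.
Variable R : realType.
Local Notation phi0 := (@g2_model R).
Local Notation psi0 := (std_hodge (@g2_model R)).
Local Notation Phi0 := (@spin7_model R).

Lemma cov_delta m n (E : 'M[R]_(m, n)) i k :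
  (forall j, E i j = (j == k)%:R) -> cov E i = dx R k.
Proof.
move=> h; rewrite /cov (bigD1 k) //= h eqxx scale1r big1 ?addr0 // => j jk.
by rewrite h (negbTE jk) scale0r.
Qed.

(** The projection of R^8 onto the first seven coordinates: the model has its extra covector e^8
    last, while the cylinder has t first. *)
Definition J78 : 'M[R]_(7, 7 + 1) := row_mx 1%:M 0.

Lemma cov_J78 (i : 'I_7) : cov J78 i = dx R (lshift 1 i).
Proof.
apply: cov_delta => j; rewrite mxE; case: splitP => k jk; rewrite !mxE.
  by congr (_%:R); rewrite eq_sym -!(inj_eq val_inj) /= jk.
by rewrite -(inj_eq val_inj) /= jk eqn_leq leqNgt (leq_trans (ltn_ord i)) ?leq_addr.
Qed.

(** The bound excludes the index 8, for which [inord] falls back to 0 in 'I_7 but not in 'I_8. *)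
Lemma pull_J78 p : all (fun a => all (fun k => k <= 7)%N a.2) p ->
  pull J78 (rpoly_val 6 R p) = rpoly_val 7 R p.
Proof.
move=> /allP h; rewrite /rpoly_val pull_sum !big_seq; apply: eq_bigr => a /h {h} h.
rewrite pullZ; congr (_ *: _); elim: a.2 h => [|k s IH] /=; first by rewrite pull_ext1.
case/andP => k7 /IH {}IH; rewrite pull_dxl IH cov_J78; congr (wedge (dx R _) _).
by apply: val_inj; rewrite /= !inordK //; case: k k7 => //= k /ltnW.
Qed.

Lemma spin7_split :
  Phi0 = wedge (pull J78 phi0) (dx R (rshift 7 0 : 'I_(7 + 1))) + pull J78 psi0.
Proof.
rewrite g2_star_ev g2_ev !pull_J78 // spin7_ev ev_cat ev_mul ev1 /= wedge1r.
by congr (wedge _ (dx R _) + _); apply: val_inj; rewrite /= inordK.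
Qed.

(** Matrix of the projection that forgets t; pulling back along it is [pr_pull]. *)
Definition inclr n : 'M[R]_(n, 1 + n) := row_mx 0 1%:M.

(** The coframe (f E, dt). Rows follow the model, with dt as the last covector; columns follow the
    cylinder, with t as the first coordinate. *)
Definition spin7_frame (f : R) (E : 'M[R]_7) : 'M[R]_8 :=
  (col_mx (f *: (E *m inclr 7)) (row_mx 1%:M 0) : 'M[R]_(7 + 1, 1 + 7)).

Lemma spin7_frameEu f E (i : 'I_7) (j : 'I_(1 + 7)) :
  spin7_frame f E (lshift 1 i) j = f * row_mx 0 E i j.
Proof.
rewrite /spin7_frame (col_mxEu (f *: (E *m inclr 7)) (row_mx 1%:M 0)) mxE.
by rewrite /inclr mul_mx_row mulmx0 mulmx1.
Qed.

Lemma spin7_frameEd f E (j : 'I_(1 + 7)) : spin7_frame f E (rshift 7 0) j = (j == 0)%:R.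
Proof.
rewrite /spin7_frame (col_mxEd (f *: (E *m inclr 7)) (row_mx 1%:M 0)) mxE.
have -> : (j == 0) = (j == 0 :> nat) by rewrite -(inj_eq val_inj).
by case: splitP => k ->; rewrite ?ord1 !mxE.
Qed.

Lemma pull_spin7_frame (f : R) (E : 'M[R]_7) :
  pull (spin7_frame f E) Phi0 =
  f ^+ 3 *: wedge (pull (E *m inclr 7) phi0) (dx R (0 : 'I_8))
  + f ^+ 4 *: pull (E *m inclr 7) psi0.
Proof.
have JG : J78 *m (spin7_frame f E : 'M[R]_(7 + 1, 8)) = f *: (E *m inclr 7).
  by rewrite mul_row_col mul1mx mul0mx addr0.
rewrite spin7_split pullD pull_wedge !pull_comp !JG pull_dx.
rewrite (pull_scale _ _ (@homog_g2 R)) (pull_scale _ _ (@homog_g2_star R)) wedgeZl.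
by congr (_ *: wedge _ _ + _); apply: cov_delta => j; exact: spin7_frameEd.
Qed.

Lemma spin7_frame_unit (f : R) (E : 'M[R]_7) : f != 0 -> E \in unitmx ->
  spin7_frame f E \in unitmx.
Proof.
move=> f0 uE.
(* The explicit inverse: undo f E and bring t back to the front. *)
pose H : 'M[R]_(1 + 7, 7 + 1) := row_mx (col_mx 0 (f^-1 *: invmx E)) (col_mx 1%:M 0).
suff : (spin7_frame f E : 'M[R]_(7 + 1, 1 + 7)) *m H = 1%:M.
  by move=> /(@mulmx1_unit _ 8)[].
rewrite /spin7_frame /H /inclr [E *m _]mul_mx_row mulmx0 mulmx1 scale_row_mx scaler0.
rewrite mul_col_row !mul_row_col !mul0mx !mulmx0 !mul1mx !addr0 !add0r.
rewrite -scalemxAl -scalemxAr scalerA mulfV // scale1r mulmxV //.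
by rewrite -scalar_mx_block.
Qed.

Lemma adapted_spin7_frame (f : R) (E : 'M[R]_7) : f != 0 -> E \in unitmx ->
  adapted Phi0 (f ^+ 3 *: wedge (pull (E *m inclr 7) phi0) (dx R (0 : 'I_8))
    + f ^+ 4 *: pull (E *m inclr 7) psi0) (spin7_frame f E).
Proof. by move=> f0 uE; split; [exact: spin7_frame_unit|rewrite pull_spin7_frame]. Qed.

Lemma pullK n (E : 'M[R]_n) a : E \in unitmx -> pull (invmx E) (pull E a) = a.
Proof. by move=> uE; rewrite pull_comp mulmxV // pull1. Qed.

Lemma pullVK n (E : 'M[R]_n) a : E \in unitmx -> pull E (pull (invmx E) a) = a.
Proof. by move=> uE; rewrite pull_comp mulVmx // pull1. Qed.

(** The contraction condition is natural under pullback, so it passes from the model to [Phi]. Its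
    form does not mention G, hence it applies to whichever coframe [xget] selects in [star8]. *)
Lemma spin7_48_adapted (Phi c : ext R 8) (G : 'M[R]_8) : adapted Phi0 Phi G ->
  homog 5 c ->
  wedge Phi (coframe_hodge G c) = 0 <-> forall v, wedge (contract v Phi) c = 0.
Proof.
move=> [uG ->] hc; set c' := pull (invmx G) c.
have cE : c = pull G c' by rewrite pullVK.
have hc' : homog 5 c' by exact: homog_pull.
rewrite /coframe_hodge -/c' -pull_wedge cE; split.
  move/(congr1 (pull (invmx G))); rewrite pullK // pull0 => /(spin7_48P hc') h v.
  by rewrite contract_pull -pull_wedge h pull0.
move=> h; rewrite (_ : wedge Phi0 _ = 0) ?pull0 //; apply/(spin7_48P hc') => v.
have := h (invmx G *m v); rewrite contract_pull mulmxA mulmxV // mul1mx -pull_wedge.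
by move/(congr1 (pull (invmx G))); rewrite pullK // pull0.
Qed.

Lemma spin7_wedge_inj_adapted (Phi a : ext R 8) (G : 'M[R]_8) :
  adapted Phi0 Phi G -> homog 1 a ->
  (forall v, wedge (contract v Phi) (wedge a Phi) = 0) -> a = 0.
Proof.
move=> [uG ->] ha h; set a' := pull (invmx G) a.
have aE : a = pull G a' by rewrite pullVK.
rewrite aE (spin7_wedge_inj (a := a')) ?pull0 //; first exact: homog_pull.
move=> v; have := h (invmx G *m v).
rewrite contract_pull mulmxA mulmxV // mul1mx aE -!pull_wedge.
by move/(congr1 (pull (invmx G))); rewrite pullK // pull0.
Qed.

Section Lambda5.
Variables (t1 t2 t3 : ext R 7) (K : 'M[R]_(7, 8)) (j : 'I_8) (f : R).
Hypotheses (h1 : homog 1 t1) (h2 : homog 2 t2) (h3 : homog 3 t3).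
Hypotheses (t2psi : wedge t2 psi0 = 0) (t3phi : wedge t3 phi0 = 0)
  (t3psi : wedge t3 psi0 = 0).

(** Three parts of i_v Phi meet four parts of lambda5. Of the twelve products, two contain dt twice,
    four are pulled back from 8-forms on R^7, one contains phi0 /\ phi0, and three vanish by the
    conditions on t2 and t3. The two remaining ones involve t1 and cancel. *)
Lemma contract_warped_lambda5 (v : 'cV[R]_8) :
  wedge (contract v (f ^+ 3 *: wedge (pull K phi0) (dx R j) + f ^+ 4 *: pull K psi0))
    (- (3%:R / 7%:R) *: (f ^+ 3 *: wedge (wedge (pull K t1) (pull K phi0)) (dx R j))
     + (4%:R / 7%:R) *: (f ^+ 4 *: wedge (pull K t1) (pull K psi0))
     + f ^+ 4 *: wedge (pull K t2) (pull K phi0)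
     + f ^+ 3 *: wedge (pull K (std_hodge t3)) (dx R j)) = 0.
Proof.
pose w := K *m v; set d := dx R j.
have h3s : homog 4 (std_hodge t3) by exact: homog_star_t3.
have ha : homog 2 (contract w phi0) by apply: homog_contract; exact: homog_g2.
have hb : homog 3 (contract w psi0) by apply: homog_contract; exact: homog_g2_star.
have hp := @homog_g2 R; have hq := @homog_g2_star R.
have hd : homog 1 d by exact: homog_dx.
rewrite contractD !contractZ (contract_wedge _ _ (homog_pull K hp)) !contract_pull -/w
  contract_dx1.
rewrite wedgeZr wedge1r.
have dd k (x : ext R 8) : homog k x -> wedge d (wedge x d) = 0.
  by move=> hx; rewrite wedgeA (wedgeC hd hx) wedgeZl -wedgeA wedge_dx_sq wedge0r scaler0.
have big k (x : ext R 7) : (7 < k)%N -> homog k x -> pull K x = 0.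
  by move=> k7 hx; rewrite (homog_gt k7 hx) pull0.
set p := pull K phi0; set q := pull K psi0; set s := pull K t1; set r := pull K t2.
set u := pull K (std_hodge t3); set a := pull K (contract w phi0);
  set b := pull K (contract w psi0).
have d1 : wedge d (wedge s (wedge p d)) = 0.
  rewrite [wedge s _]wedgeA -pull_wedge; apply: (dd 4); apply: homog_pull.
  exact: (homog_wedge h1 hp).
have d2 : wedge d (wedge s q) = - wedge s (wedge q d).
  have h5 := homog_pull K (homog_wedge h1 hq).
  by rewrite -pull_wedge (wedgeC hd h5) -signr_odd /= expr1 scaleN1r pull_wedge -wedgeA.
have d3 : wedge d (wedge r p) = - wedge r (wedge p d).
  have h5 := homog_pull K (homog_wedge h2 hp).
  by rewrite -pull_wedge (wedgeC hd h5) -signr_odd /= expr1 scaleN1r pull_wedge -wedgeA.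
have d4 : wedge d (wedge u d) = 0 by apply: (dd 4); exact: homog_pull.
have p1 : wedge p (wedge s (wedge p d)) = 0.
  rewrite !wedgeA -!pull_wedge (wedgeC hp h1) wedgeZl -wedgeA g2_sq.
  by rewrite wedge0r scaler0 pull0 wedge0l.
have p2 : wedge p (wedge s q) = 0.
  by rewrite -!pull_wedge; apply: (big 8) => //; exact: (homog_wedge hp (homog_wedge h1 hq)).
have p3 : wedge p (wedge r p) = 0.
  by rewrite -!pull_wedge; apply: (big 8) => //; exact: (homog_wedge hp (homog_wedge h2 hp)).
have p4 : wedge p (wedge u d) = 0.
  by rewrite wedgeA -!pull_wedge wedge_g2_star_t3 // pull0 wedge0l.
have b1 : wedge b (wedge s (wedge p d)) = - (4%:R / 3%:R) *: wedge a (wedge s (wedge q d)).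
  have E (x y : ext R 8) : wedge x (wedge s (wedge y d)) = wedge (wedge x (wedge s y)) d.
    by rewrite !wedgeA.
  by rewrite !E -!pull_wedge wedge_contract_t1 // pullZ wedgeZl.
have b2 : wedge b (wedge s q) = 0.
  by rewrite -!pull_wedge; apply: (big 8) => //; exact: (homog_wedge hb (homog_wedge h1 hq)).
have b3 : wedge b (wedge r p) = 0.
  by rewrite -!pull_wedge; apply: (big 8) => //; exact: (homog_wedge hb (homog_wedge h2 hp)).
have b4 : wedge b (wedge u d) = 0.
  by rewrite wedgeA -!pull_wedge wedge_contract_star_t3 // pull0 wedge0l.
have a1 : wedge a (wedge r (wedge p d)) = 0.
  by rewrite [wedge r _]wedgeA [LHS]wedgeA -!pull_wedge wedge_contract_t2 // pull0 wedge0l.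
rewrite !(wedgeDl, wedgeZl, wedgeDr, wedgeZr) -!wedgeA.
rewrite d1 d2 d3 d4 p1 p2 p3 p4 b1 b2 b3 b4 !wedgeNr a1 !wedge0r.
rewrite !(scaler0, oppr0, addr0, add0r) !scalerN !scalerA -scaleNr -scalerDl.
(* The coefficient left is f^7 times -4/7 + (3/7) (4/3). *)
by rewrite (_ : _ + _ = 0) ?scale0r //; field.
Qed.

End Lambda5.

End Pointwise.

Local Open Scope classical_set_scope.
Local Open Scope ring_scope.

(** * Smooth functions and forms in a chart *)

Section Smooth.
Variables (R : realType) (n : nat).
Implicit Types (U V : set 'rV[R]_n) (g h : 'rV[R]_n -> R).

Lemma near_eqfun U g h x : open U -> (forall y, U y -> g y = h y) -> U x ->
  {near x, g =1 h}.
Proof. by move=> oU gh Ux; apply: filterS (open_nbhs_nbhs (conj oU Ux)) => y /gh. Qed.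

Lemma continuous_ext U g h x : open U -> (forall y, U y -> g y = h y) -> U x ->
  {for x, continuous g} -> {for x, continuous h}.
Proof.
move=> oU gh Ux cg; rewrite /prop_for /continuous_at -(gh _ Ux).
exact: (cvg_trans (near_eq_cvg (near_eqfun oU gh Ux)) cg).
Qed.

Lemma Ck_ext k U g h : open U -> (forall x, U x -> g x = h x) -> Ck k U g -> Ck k U h.
Proof.
move=> oU; elim: k g h => [|k IH] g h gh [cg dg]; (split=> [x Ux|//]).
- exact: continuous_ext gh _ (cg x Ux).
- exact: continuous_ext gh _ (cg x Ux).
- move=> j; have [dj cj] := dg j; split=> [x Ux|].
    exact: near_eq_derivable (near_eqfun oU gh Ux) (dj x Ux).
  by apply: IH cj => x Ux; exact: near_eq_derive (near_eqfun oU gh Ux).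
Qed.

Lemma Ck_sub k U V g : V `<=` U -> Ck k U g -> Ck k V g.
Proof.
move=> VU; elim: k g => [|k IH] g [cg dg]; split=> //.
- by move=> x /VU; exact: cg.
- by move=> x /VU; exact: cg.
- by move=> j; have [dj cj] := dg j; split; [move=> x /VU; exact: dj|exact: IH].
Qed.

Lemma CkW k U g : Ck k.+1 U g -> Ck k U g.
Proof.
elim: k g => [|k IH] g [cg dg]; split=> // j.
by have [dj cj] := dg j; split=> //; exact: IH.
Qed.

Lemma Ck_cst k U (c : R) : Ck k U (fun=> c).
Proof.
elim: k c => [|k IH] c; split=> //.
- by move=> x _; exact: cst_continuous.
- by move=> x _; exact: cst_continuous.
- move=> j; split=> [x _|]; first exact: derivable_cst.
  rewrite (_ : pderiv _ _ = fun=> 0) //; apply/funext => x; exact: derive_cst.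
Qed.

Lemma CkD k U g h : open U -> Ck k U g -> Ck k U h -> Ck k U (fun x => g x + h x).
Proof.
move=> oU; elim: k g h => [|k IH] g h [cg dg] [ch dh]; (split=> [x Ux|//]).
- exact: (cvgD (cg x Ux) (ch x Ux)).
- exact: (cvgD (cg x Ux) (ch x Ux)).
- move=> j; have [djg cjg] := dg j; have [djh cjh] := dh j.
  split=> [x Ux|]; first exact: (derivableD (djg x Ux) (djh x Ux)).
  apply: Ck_ext oU _ (IH _ _ cjg cjh) => x Ux.
  by rewrite /pderiv (deriveD (djg x Ux) (djh x Ux)).
Qed.

Lemma CkM k U g h : open U -> Ck k U g -> Ck k U h -> Ck k U (fun x => g x * h x).
Proof.
move=> oU; elim: k g h => [|k IH] g h cg ch; (split=> [x Ux|//]).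
- exact: (cvgM (cg.1 x Ux) (ch.1 x Ux)).
- exact: (cvgM (cg.1 x Ux) (ch.1 x Ux)).
- move=> j; have [djg cjg] := cg.2 j; have [djh cjh] := ch.2 j.
  split=> [x Ux|]; first exact: (derivableM (djg x Ux) (djh x Ux)).
  apply: Ck_ext oU _ (CkD oU (IH _ _ (CkW cg) cjh) (IH _ _ (CkW ch) cjg)) => x Ux.
  by rewrite /pderiv (deriveM (djg x Ux) (djh x Ux)).
Qed.

Lemma CkV k U g : open U -> (forall x, U x -> g x != 0) -> Ck k U g ->
  Ck k U (fun x => (g x)^-1).
Proof.
move=> oU g0; elim: k => [|k IH] cg; (split=> [x Ux|//]).
- exact: (cvgV (g0 x Ux) (cg.1 x Ux)).
- exact: (cvgV (g0 x Ux) (cg.1 x Ux)).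
- move=> j; have [djg cjg] := cg.2 j.
  split=> [x Ux|]; first exact: (derivableV (g0 x Ux) (djg x Ux)).
  have cV := IH (CkW cg).
  apply: Ck_ext oU _ (CkM oU (CkM oU (Ck_cst _ _ (-1)) (CkM oU cV cV)) cjg) => x Ux.
  by rewrite /pderiv (deriveV (g0 x Ux) (djg x Ux)) expr2 invfM mulN1r.
Qed.

Lemma smooth_ext U g h : open U -> (forall x, U x -> g x = h x) ->
  smooth_on U g -> smooth_on U h.
Proof. by move=> oU gh sg k; exact: Ck_ext (sg k). Qed.

Lemma smooth_sub U V g : V `<=` U -> smooth_on U g -> smooth_on V g.
Proof. by move=> VU sg k; exact: Ck_sub (sg k). Qed.

Lemma smooth_cst U (c : R) : smooth_on U (fun=> c).
Proof. by move=> k; exact: Ck_cst. Qed.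

Lemma smoothD U g h : open U -> smooth_on U g -> smooth_on U h ->
  smooth_on U (fun x => g x + h x).
Proof. by move=> oU sg sh k; exact: CkD. Qed.

Lemma smoothM U g h : open U -> smooth_on U g -> smooth_on U h ->
  smooth_on U (fun x => g x * h x).
Proof. by move=> oU sg sh k; exact: CkM. Qed.

Lemma smoothV U g : open U -> (forall x, U x -> g x != 0) -> smooth_on U g ->
  smooth_on U (fun x => (g x)^-1).
Proof. by move=> oU g0 sg k; exact: CkV. Qed.

Lemma smooth_sum U (T : Type) (r : seq T) (P : pred T) (F : T -> 'rV[R]_n -> R) :
  open U -> (forall i, P i -> smooth_on U (F i)) ->
  smooth_on U (fun x => \sum_(i <- r | P i) F i x).
Proof.
move=> oU sF; elim: r => [|i r IH].
  apply: (smooth_ext oU (g := fun=> 0)) (smooth_cst _ _) => x _.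
  by rewrite big_nil.
case Pi: (P i); last by apply: (smooth_ext oU) IH => x _; rewrite big_cons Pi.
by apply: (smooth_ext oU) (smoothD oU (sF i Pi) IH) => x _; rewrite big_cons Pi.
Qed.

Lemma smooth_pderiv U g j : smooth_on U g -> smooth_on U (pderiv j g).
Proof. by move=> sg k; exact: ((sg k.+1).2 j).2. Qed.

Lemma smooth_derivable U g j x : smooth_on U g -> U x -> derivable g x (delta_mx 0 j).
Proof. by move=> sg Ux; exact: ((sg 1).2 j).1. Qed.

End Smooth.

(** * Functions on the cylinder depending only on x or only on t *)

Section Composition.
Variable R : realType.

(** The difference quotients themselves coincide, so existence and value of directional derivatives
    are transferred together, without total differentiability of g. *)
Lemma growth_linear (U V : normedModType R) (W : normedModType R) (L : {linear U -> V})
    (g : V -> W) z v :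
  (fun h : R => h^-1 *: (((g \o L) \o shift z) (h *: v) - (g \o L) z)) =
  (fun h : R => h^-1 *: ((g \o shift (L z)) (h *: L v) - g (L z))).
Proof. by apply/funext => h /=; rewrite linearP. Qed.

Lemma derive_linear (U V W : normedModType R) (L : {linear U -> V}) (g : V -> W) z v :
  'D_v (g \o L) z = 'D_(L v) g (L z).
Proof. by rewrite /derive growth_linear. Qed.

Lemma derivable_linear (U V W : normedModType R) (L : {linear U -> V}) (g : V -> W) z v :
  derivable g (L z) (L v) -> derivable (g \o L) z v.
Proof. by rewrite /derivable growth_linear. Qed.

Lemma rsubmx_delta0 n : rsubmx (delta_mx 0 0 : 'rV[R]_(1 + n)) = 0.
Proof. by apply/rowP => i; rewrite !mxE. Qed.

Lemma rsubmx_delta n (j : 'I_n) :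
  rsubmx (delta_mx 0 (rshift 1 j) : 'rV[R]_(1 + n)) = delta_mx 0 j.
Proof. by apply/rowP => i; rewrite !mxE (inj_eq (@rshift_inj _ _)). Qed.

Lemma ord_1n n (j : 'I_(1 + n)) : j = lshift n 0 \/ exists k, j = rshift 1 k.
Proof.
by case: (splitP j) => k jk; [left|right; exists k]; apply: val_inj; rewrite /= jk // ord1.
Qed.

Lemma lshift_ord0 n : lshift n (0 : 'I_1) = 0 :> 'I_(1 + n).
Proof. exact: val_inj. Qed.

Lemma pderiv_rsubmx0 n (g : 'rV[R]_n -> R) (z : 'rV[R]_(1 + n)) :
  pderiv 0 (fun z : 'rV[R]_(1 + n) => g (rsubmx z)) z = 0.
Proof.
rewrite /pderiv (derive_linear (rsubmx : {linear 'rV[R]_(1 + n) -> 'rV[R]_n}) g).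
by rewrite [X in 'D_X _ _]rsubmx_delta0 derive0.
Qed.

Lemma pderiv_rsubmx n (g : 'rV[R]_n -> R) (z : 'rV[R]_(1 + n)) k :
  pderiv (rshift 1 k) (fun z : 'rV[R]_(1 + n) => g (rsubmx z)) z = pderiv k g (rsubmx z).
Proof.
rewrite /pderiv (derive_linear (rsubmx : {linear 'rV[R]_(1 + n) -> 'rV[R]_n}) g).
by rewrite [X in 'D_X _ _]rsubmx_delta.
Qed.

Lemma smooth_rsubmx n (U : set 'rV[R]_n) (g : 'rV[R]_n -> R) : smooth_on U g ->
  smooth_on [set z : 'rV[R]_(1 + n) | U (rsubmx z)] (fun z => g (rsubmx z)).
Proof.
suff H k : Ck k U g ->
    Ck k [set z : 'rV[R]_(1 + n) | U (rsubmx z)] (fun z => g (rsubmx z)).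
  by move=> sg k; exact: H.
elim: k g => [|k IH] g cg; (split=> [x Ux|//]).
- apply: (@continuous_comp _ _ _ (@rsubmx R 1 1 n) g); [exact: continuous_rsubmx|exact: cg.1].
- apply: (@continuous_comp _ _ _ (@rsubmx R 1 1 n) g); [exact: continuous_rsubmx|exact: cg.1].
move=> j; have [->|[l ->]] := ord_1n j.
  rewrite lshift_ord0; split=> [x Ux|].
    apply: (derivable_linear (L := rsubmx : {linear 'rV[R]_(1 + n) -> 'rV[R]_n})).
    by rewrite [X in derivable _ _ X]rsubmx_delta0; exact: derivable0.
  rewrite (_ : pderiv _ _ = fun=> 0); first exact: Ck_cst.
  by apply/funext => x; rewrite pderiv_rsubmx0.
split=> [x Ux|].
  apply: (derivable_linear (L := rsubmx : {linear 'rV[R]_(1 + n) -> 'rV[R]_n})).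
  by rewrite [X in derivable _ _ X]rsubmx_delta; exact: (cg.2 l).1.
rewrite (_ : pderiv _ _ = fun z => pderiv l g (rsubmx z)); first exact: IH (cg.2 l).2.
by apply/funext => x; rewrite pderiv_rsubmx.
Qed.

Lemma growth_head0 n (f : R -> R) (z : 'rV[R]_(1 + n)) :
  (fun h : R => h^-1 *: (((fun z : 'rV[R]_(1 + n) => f (z 0 0)) \o shift z)
     (h *: delta_mx 0 0) - f (z 0 0))) =
  (fun h : R => h^-1 *: ((f \o shift (z 0 0)) (h *: 1) - f (z 0 0))).
Proof. by apply/funext => h /=; rewrite !mxE !eqxx. Qed.

Lemma pderiv_head0 n (f : R -> R) (z : 'rV[R]_(1 + n)) :
  pderiv 0 (fun z : 'rV[R]_(1 + n) => f (z 0 0)) z = derive1 f (z 0 0).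
Proof. by rewrite /pderiv derive1E /derive growth_head0. Qed.

Lemma derivable_head0 n (f : R -> R) (z : 'rV[R]_(1 + n)) :
  derivable f (z 0 0) 1 ->
  derivable (fun z : 'rV[R]_(1 + n) => f (z 0 0)) z (delta_mx 0 0).
Proof. by rewrite /derivable growth_head0. Qed.

Lemma growth_head n (f : R -> R) (z : 'rV[R]_(1 + n)) (k : 'I_n) :
  (fun h : R => h^-1 *: (((fun z : 'rV[R]_(1 + n) => f (z 0 0)) \o shift z)
     (h *: delta_mx 0 (rshift 1 k)) - f (z 0 0))) = (fun=> 0).
Proof.
apply/funext => h /=; rewrite !mxE (_ : (0 == rshift 1 k) = false) //.
by rewrite ?andbF ?mulr0 ?add0r ?subrr ?scaler0.
Qed.

Lemma pderiv_head n (f : R -> R) (z : 'rV[R]_(1 + n)) k :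
  pderiv (rshift 1 k) (fun z : 'rV[R]_(1 + n) => f (z 0 0)) z = 0.
Proof. by rewrite /pderiv /derive growth_head lim_cst. Qed.

Lemma derivable_head n (f : R -> R) (z : 'rV[R]_(1 + n)) k :
  derivable (fun z : 'rV[R]_(1 + n) => f (z 0 0)) z (delta_mx 0 (rshift 1 k)).
Proof. by rewrite /derivable growth_head; exact: is_cvg_cst. Qed.

Lemma smooth_head n (I : set R) (f : R -> R) : smooth1_on I f ->
  smooth_on [set z : 'rV[R]_(1 + n) | I (z 0 0)] (fun z => f (z 0 0)).
Proof.
(* Stated for all iterated derivatives of f at once: the t-derivative raises m while k drops. *)
move=> sf; suff H : forall k m, Ck k [set z : 'rV[R]_(1 + n) | I (z 0 0)]
    (fun z => derive1n m f (z 0 0)) by move=> k; exact: (H k 0%N).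
have cf m (z : 'rV[R]_(1 + n)) : I (z 0 0) ->
    {for z, continuous (fun z : 'rV[R]_(1 + n) => derive1n m f (z 0 0))}.
  move=> Iz; apply: (@continuous_comp _ _ _ (fun z : 'rV[R]_(1 + n) => z 0 0)).
    exact: coord_continuous.
  by apply/differentiable_continuous/derivable1_diffP; exact: sf.
elim=> [|k IH] m; (split=> [x Ux|//]); try exact: cf.
move=> j; have [->|[l ->]] := ord_1n j.
  rewrite lshift_ord0; split=> [x Ux|]; first by apply: derivable_head0; exact: sf.
  rewrite (_ : pderiv _ _ = fun z => derive1n m.+1 f (z 0 0)); first exact: IH.
  by apply/funext => x; rewrite pderiv_head0 derive1nS.
split=> [x Ux|]; first exact: derivable_head.
rewrite (_ : pderiv _ _ = fun=> 0); first exact: Ck_cst.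
by apply/funext => x; rewrite pderiv_head.
Qed.

End Composition.

Section SmoothExt.
Variables (R : realType) (n : nat) (U : set 'rV[R]_n).
Hypothesis oU : open U.

(** The dimension m of the exterior algebra is separate from that of the domain, because forms of M
    are read as functions on the cylinder before being pulled back. *)
Definition smooth_form m (w : 'rV[R]_n -> ext R m) : Prop :=
  forall S, smooth_on U (fun x => w x S).

Lemma smooth_form_ext m (w v : 'rV[R]_n -> ext R m) :
  (forall x, U x -> w x = v x) -> smooth_form w -> smooth_form v.
Proof. by move=> wv sw S; apply: (smooth_ext oU) (sw S) => x /wv ->. Qed.

Lemma smooth_form_cst m (a : ext R m) : smooth_form (fun=> a).
Proof. by move=> S; exact: smooth_cst. Qed.

Lemma smooth_formD m (w v : 'rV[R]_n -> ext R m) :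
  smooth_form w -> smooth_form v -> smooth_form (fun x => w x + v x).
Proof.
by move=> sw sv S; apply: (smooth_ext oU) (smoothD oU (sw S) (sv S)) => x _; rewrite ffunE.
Qed.

Lemma smooth_formZ m (g : 'rV[R]_n -> R) (w : 'rV[R]_n -> ext R m) :
  smooth_on U g -> smooth_form w -> smooth_form (fun x => g x *: w x).
Proof.
by move=> sg sw S; apply: (smooth_ext oU) (smoothM oU sg (sw S)) => x _; rewrite ffunE.
Qed.

Lemma smooth_formZc m (c : R) (w : 'rV[R]_n -> ext R m) :
  smooth_form w -> smooth_form (fun x => c *: w x).
Proof. by move=> sw; apply: smooth_formZ => //; exact: smooth_cst. Qed.

Lemma smooth_form_sum m (T : Type) (r : seq T) (P : pred T)
    (F : T -> 'rV[R]_n -> ext R m) :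
  (forall i, P i -> smooth_form (F i)) ->
  smooth_form (fun x => \sum_(i <- r | P i) F i x).
Proof.
move=> sF S.
have := smooth_sum r oU (fun i Pi => sF i Pi S).
by apply: (smooth_ext oU) => x _; rewrite sum_ffunE.
Qed.

Lemma smooth_form_wedge m (w v : 'rV[R]_n -> ext R m) :
  smooth_form w -> smooth_form v -> smooth_form (fun x => wedge (w x) (v x)).
Proof.
move=> sw sv S.
have := smooth_sum (index_enum _) oU (P := fun A : {set 'I_m} => A \subset S)
  (F := fun A x => shuffle_sign R A (S :\: A)%SET * w x A * v x (S :\: A)%SET).
move=> H; apply: (smooth_ext oU) (H _) => [x _|A _]; first by rewrite ffunE.
by apply: smoothM => //; apply: smoothM => //; exact: smooth_cst.
Qed.

Lemma smooth_form_pull m p (E : 'rV[R]_n -> 'M[R]_(m, p)) (w : 'rV[R]_n -> ext R m) :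
  (forall i j, smooth_on U (fun x => E x i j)) -> smooth_form w ->
  smooth_form (fun x => pull (E x) (w x)).
Proof.
move=> sE sw; rewrite /pull; apply: smooth_form_sum => S _.
apply: smooth_formZ => //; elim: (enum S) => [|i s IH] /=; first exact: smooth_form_cst.
apply: smooth_form_wedge => //; apply: smooth_form_sum => j _.
by apply: smooth_formZ => //; exact: smooth_form_cst.
Qed.

End SmoothExt.

Section SmoothLocal.
Variables (R : realType) (n : nat).

(** Each condition in [Ck] concerns the globally defined function at a single point of the set, so
    it can be checked point by point. *)
Lemma smooth_local (U : set 'rV[R]_n) (g : 'rV[R]_n -> R) :
  (forall x, U x -> exists V, V x /\ smooth_on V g) -> smooth_on U g.
Proof.
move=> h k; have {h} : forall x, U x -> exists V, V x /\ Ck k V g.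
  by move=> x /h[V [Vx sV]]; exists V; split.
elim: k g => [|k IH] g h; (split=> [x /h[V [Vx [cV _]]]|//]); try exact: cV.
move=> j; split=> [x /h[V [Vx [_ dV]]]|]; first exact: (dV j).1.
by apply: IH => x /h[V [Vx [_ dV]]]; exists V; split; [|exact: (dV j).2].
Qed.

End SmoothLocal.

(** * Differential forms on an atlas *)

Section FormOps.
Variables (R : realType) (n : nat) (N : atlas R n).
Implicit Types (w v : dform N).

Lemma fwedgeE w v i x : (w \^ v) i x = wedge (w i x) (v i x).
Proof. by []. Qed.
Lemma faddE w v i x : (w + v) i x = w i x + v i x.
Proof. by []. Qed.
Lemma fscaleE (c : R) w i x : (c *: w) i x = c *: w i x.
Proof. by []. Qed.

Definition fsmooth w := forall i : idx N, smooth_form (chart_img i) (w i).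

Lemma overlap_imgl (i j : idx N) : overlap_img i j `<=` chart_img i.
Proof. by move=> x [p [pi pj] <-]; exists p. Qed.

Lemma trans_img (i j : idx N) x : overlap_img i j x -> chart_img j (trans i j x).
Proof.
move=> [p [pi pj] <-]; have : exists y, exists p', [/\ dom i p', dom j p',
    chart i p' = chart i p & chart j p' = y] by exists (chart j p), p.
by move/(@xgetPex _ 0) => [p' [_ p'j _ E]]; exists p'.
Qed.

Hypothesis oN : forall i : idx N, open (chart_img i).

Lemma Omega_ext k w v : w =f v -> Omega k w -> Omega k v.
Proof.
move=> wv [sw hw tw]; split=> [i S|i x ix|i j x ijx].
- by apply: smooth_ext (sw i S) => // x ix; rewrite wv.
- by rewrite -wv //; exact: hw.
- by rewrite -!wv; [exact: tw|exact: trans_img|exact: overlap_imgl ijx].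
Qed.

Lemma OmegaD k w v : Omega k w -> Omega k v -> Omega k (w + v).
Proof.
move=> [sw hw tw] [sv hv tv]; split=> [i|i x ix|i j x ijx].
- exact: (@smooth_formD _ _ _ (@oN i) _ (w i) (v i) (sw i) (sv i)).
- by rewrite faddE; apply: homogD; [exact: hw|exact: hv].
- by rewrite !faddE pullD (tw i j) // (tv i j).
Qed.

Lemma OmegaZ k (c : R) w : Omega k w -> Omega k (c *: w).
Proof.
move=> [sw hw tw]; split=> [i|i x ix|i j x ijx].
- exact: (@smooth_formZc _ _ _ (@oN i) _ c (w i) (sw i)).
- by rewrite fscaleE; apply: homogZ; exact: hw.
- by rewrite !fscaleE pullZ (tw i j).
Qed.

Lemma Omega_wedge p q w v : Omega p w -> Omega q v -> Omega (p + q) (w \^ v).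
Proof.
move=> [sw hw tw] [sv hv tv]; split=> [i|i x ix|i j x ijx].
- exact: (@smooth_form_wedge _ _ _ (@oN i) _ (w i) (v i) (sw i) (sv i)).
- by apply: homog_wedge; [exact: hw|exact: hv].
- by rewrite !fwedgeE pull_wedge (tw i j) // (tv i j).
Qed.

Lemma fsmooth_fext w : fsmooth w -> fsmooth (fext w).
Proof.
move=> sw i; rewrite /fext.
apply: smooth_form_sum => // j _; apply: smooth_form_wedge => //.
  exact: smooth_form_cst.
move=> S; apply: (smooth_ext (@oN i)) (smooth_pderiv j (sw i S)) => x _.
by rewrite ffunE.
Qed.

End FormOps.

(** * The Hodge star of a G_2-structure *)

Section Star7.
Variables (R : realType).
Local Notation phi0 := (@g2_model R).
Local Notation psi0 := (std_hodge (@g2_model R)).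

(** The two coframes differ by A = E' J E^-1, which fixes phi0 and hence commutes with the star. J =
    1 gives independence of the coframe; J the Jacobian of a coordinate change gives the
    transformation law. *)
Lemma coframe_hodge_pull (p p' : ext R 7) (E E' J : 'M[R]_7) k a :
  adapted phi0 p E -> adapted phi0 p' E' -> p = pull J p' -> homog k a ->
  coframe_hodge E (pull J a) = pull J (coframe_hodge E' a).
Proof.
move=> [uE ->] [uE' ->] Jp ha; pose A := E' *m J *m invmx E.
have AE : A *m E = E' *m J by rewrite /A mulmxKV.
have Aphi : pull A phi0 = phi0.
  by rewrite /A -pull_comp -pull_comp -Jp pullK.
rewrite /coframe_hodge.
have -> : pull (invmx E) (pull J a) = pull A (pull (invmx E') a).
  by rewrite !pull_comp /A !mulmxA mulVmx // mul1mx.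
rewrite (@g2_hodge_pull _ _ k) //; last exact: homog_pull.
by rewrite !pull_comp AE.
Qed.

Variables (M : atlas R 7) (phi : dform M).
Hypothesis oM : forall i : idx M, open (chart_img i).
Hypothesis hphi : g2_structure phi.

Lemma g2_adapted_ex (i : idx M) x : chart_img i x -> exists E, adapted phi0 (phi i x) E.
Proof.
by move=> /hphi.2 [V [E [_ Vx _ _ aE]]]; exists (E x); exact: aE.
Qed.

Lemma star7E (i : idx M) x E k (w : dform M) : chart_img i x -> homog k (w i x) ->
  adapted phi0 (phi i x) E -> star7 phi w i x = coframe_hodge E (w i x).
Proof.
move=> ix hw aE; rewrite /star7 /fhodge.
have aE' := xgetPex 1%:M (g2_adapted_ex ix).
have := coframe_hodge_pull (J := 1%:M) aE' aE _ hw.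
by rewrite !pull1; apply.
Qed.

Lemma star7_phiE (i : idx M) x E : chart_img i x ->
  adapted phi0 (phi i x) E -> star7 phi phi i x = pull E psi0.
Proof.
move=> ix aE; have hw : homog 3 (phi i x) by have [[_ h _] _] := hphi; exact: h.
rewrite (star7E ix hw aE) /coframe_hodge; case: aE => uE ->.
by rewrite pullK.
Qed.

(** Degree and transformation law hold pointwise. Smoothness is a premise because the coframe in
    [star7] is picked at each point separately. *)
Lemma Omega_star7 k p (w : dform M) : (k + p = 7)%N -> Omega k w ->
  fsmooth (star7 phi w) -> Omega p (star7 phi w).
Proof.
move=> kp [sw hw tw] ss; split=> [i S|i x ix|i j x ijx]; first exact: ss.
  apply: homog_pull; apply: (homog_hodge kp); apply: homog_pull; exact: hw.
have ix := overlap_imgl ijx; have jy := trans_img ijx.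
have aE := xgetPex 1%:M (g2_adapted_ex ix).
have aE' := xgetPex 1%:M (g2_adapted_ex jy).
rewrite (star7E ix (hw _ _ ix) aE) (star7E jy (hw _ _ jy) aE') (tw i j) //.
apply: (coframe_hodge_pull aE aE' _ (hw _ _ jy)).
by have [[_ _ t] _] := hphi; exact: t.
Qed.

(** Near a point the selected coframe may be replaced by a smooth one E, and the star of phi is then
    the constant form psi0 pulled back along E. *)
Lemma smooth_star7_phi : fsmooth (star7 phi phi).
Proof.
move=> i S; apply: smooth_local => x ix.
have [V [E [oV Vx VU sE aE]]] := hphi.2 i x ix.
exists V; split=> //.
apply: (smooth_form_ext oV (w := fun y => pull (E y) psi0)).
  by move=> y Vy; rewrite (star7_phiE (VU _ Vy) (aE _ Vy)).
by apply: smooth_form_pull => //; exact: smooth_form_cst.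
Qed.

Lemma Omega_star7_phi : Omega 4 (star7 phi phi).
Proof. by apply: (@Omega_star7 3 4) => //; [exact: hphi.1|exact: smooth_star7_phi]. Qed.

(* Smoothness is read off the equation for [fext phi], which avoids
   differentiating the inverse of a coframe. *)
Lemma Omega_star7_tau3 tau0 tau1 tau2 tau3 :
  g2_torsion phi tau0 tau1 tau2 tau3 -> Omega 4 (star7 phi tau3).
Proof.
move=> [[[s0 _ _] [s1 _ _] _ [om3 _ _]] [dphi _]].
apply: (@Omega_star7 3 4) => // i.
have sphi : fsmooth phi := let: conj (And3 s _ _) _ := hphi in s.
apply: (smooth_form_ext (@oM i) (w := fun x => fext phi i x
  + (-1) *: (wedge (tau0 i x) (star7 phi phi i x) + 3%:R *: wedge (tau1 i x) (phi i x)))).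
  move=> x ix; rewrite dphi // !faddE !fscaleE !fwedgeE scaleN1r.
  by rewrite [_ + star7 _ _ _ _]addrC addrK.
apply: smooth_formD => //; first exact: fsmooth_fext.
apply: smooth_formZc => //; apply: smooth_formD => //.
  by apply: smooth_form_wedge => //; exact: smooth_star7_phi.
by apply: smooth_formZc => //; apply: smooth_form_wedge => //; exact: sphi.
Qed.

End Star7.

(** * The cylinder *)

Section ManifoldCharts.
Variables (R : realType) (n : nat) (M : atlas R n).
Hypothesis hM : manifold M.

Lemma open_chart_img (i : idx M) : open (chart_img i).
Proof. by have [_ _ _ /(_ i)[od _ _ h] _] := hM; exact: h. Qed.

Lemma open_overlap_img (i j : idx M) : open (overlap_img i j).
Proof.
have [_ _ _ hc _] := hM; have [odi _ _ h] := hc i; have [odj _ _ _] := hc j.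
by apply: h => [|x []//]; exact: openI.
Qed.

(** [trans] is defined by choice; injectivity of the chart on its domain identifies the chosen point
    with p. *)
Lemma trans_chart (i j : idx M) p : dom i p -> dom j p ->
  trans i j (chart i p) = chart j p.
Proof.
move=> pi pj; have : exists y, exists p', [/\ dom i p', dom j p',
    chart i p' = chart i p & chart j p' = y] by exists (chart j p), p.
move/(@xgetPex _ 0) => [p' [p'i _ E1 E2]]; rewrite /trans -E2; congr chart.
have [_ _ _ /(_ i)[_ inj _ _] _] := hM.
by apply: inj => //; rewrite inE.
Qed.

End ManifoldCharts.

Section CylinderForms.
Variables (R : realType) (n : nat) (I : set R) (M : atlas R n).
Hypotheses (hM : manifold M) (oI : open I).
Local Notation N := (cylinder I M).
Implicit Types z : 'rV[R]_(1 + n).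

Lemma row_mx_split z : z = row_mx (const_mx (z 0 0)) (rsubmx z).
Proof.
apply/rowP => j; have [->|[k ->]] := ord_1n j.
  by rewrite row_mxEl mxE lshift_ord0.
by rewrite row_mxEr mxE.
Qed.

Lemma row_mx_const0 (t : R) (x : 'rV[R]_n) : row_mx (const_mx t : 'rV_1) x 0 0 = t.
Proof. by rewrite -(lshift_ord0 n) row_mxEl mxE. Qed.

Lemma cyl_chart_img (i : idx N) :
  chart_img i = [set z : 'rV[R]_(1 + n) | I (z 0 0) /\ chart_img (i : idx M) (rsubmx z)].
Proof.
apply/seteqP; split=> [_ [[t q] /= qi <-]|z /= [Iz [q qi zq]]].
  rewrite /= row_mxKr row_mx_const0; split; last by exists q.
  exact: set_valP.
exists (exist _ (z 0 0) (mem_set Iz), q) => //=.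
by rewrite [RHS]row_mx_split -zq.
Qed.

Lemma cyl_overlap_img (i j : idx N) :
  overlap_img i j = [set z : 'rV[R]_(1 + n) | I (z 0 0) /\ overlap_img (i : idx M) j (rsubmx z)].
Proof.
apply/seteqP; split=> [_ [[t q] /= [qi qj] <-]|z /= [Iz [q [qi qj] zq]]].
  rewrite /= row_mxKr row_mx_const0; split; last by exists q.
  exact: set_valP.
exists (exist _ (z 0 0) (mem_set Iz), q) => //=.
by rewrite [RHS]row_mx_split -zq.
Qed.

Lemma open_cyl (U : set 'rV[R]_n) : open U ->
  open [set z : 'rV[R]_(1 + n) | I (z 0 0) /\ U (rsubmx z)].
Proof.
move=> oU; apply: openI.
  by apply: (@open_comp _ _ (fun z : 'rV[R]_(1 + n) => z 0 0)) => // z _; exact: coord_continuous.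
by apply: (@open_comp _ _ (@rsubmx R 1 1 n)) => // z _; exact: continuous_rsubmx.
Qed.

Lemma open_cyl_chart_img (i : idx N) : open (chart_img i).
Proof. by rewrite cyl_chart_img; apply: open_cyl; exact: open_chart_img. Qed.

Lemma cyl_trans (i j : idx N) z : overlap_img i j z ->
  trans i j z = row_mx (const_mx (z 0 0)) (trans (i : idx M) j (rsubmx z)).
Proof.
move=> zij; have : exists y, exists p', [/\ dom i p', dom j p',
    chart i p' = z & chart j p' = y].
  by case: zij => p [pi pj] zp; exists (chart j p), p.
move/(@xgetPex _ 0) => [[t q] [/= qi qj zq E]]; rewrite /trans -[LHS]E -zq.
by rewrite row_mxKr row_mx_const0 -/(trans _ _ _) trans_chart.
Qed.

Lemma cyl_jac (i j : idx N) z : overlap_img i j z ->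
  jac (trans i j) z =
    block_mx 1%:M 0 0 (jac (trans (i : idx M) j) (rsubmx z)) :> 'M[R]_(1 + n).
Proof.
move=> zij; have oij : open (overlap_img i j).
  by rewrite cyl_overlap_img; apply: open_cyl; exact: open_overlap_img.
apply/matrixP => a b; rewrite mxE.
pose F (y : 'rV[R]_(1 + n)) := (row_mx (const_mx (y 0 0)) (trans (i : idx M) j (rsubmx y))
  : 'rV[R]_(1 + n)).
(* The explicit formula for the coordinate change holds only on the overlap; it may be
   differentiated because the overlap is open. *)
have -> : pderiv b (fun y => trans i j y 0 a) z = pderiv b (fun y => F y 0 a) z.
  by apply: near_eq_derive; apply: (near_eqfun oij _ zij) => y yij; rewrite cyl_trans.
have [->|[k ->]] := ord_1n a.
  have -> : (fun y => F y 0 (lshift n 0)) = fun y => id (y 0 0).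
    by apply/funext => y; rewrite row_mxEl mxE.
  have [->|[l ->]] := ord_1n b.
    by rewrite block_mxEul mxE eqxx lshift_ord0 (pderiv_head0 id) derive1E derive_id.
  by rewrite (pderiv_head id) block_mxEur mxE.
pose g x := trans (i : idx M) j x 0 k.
have -> : (fun y => F y 0 (rshift 1 k)) = fun y => g (rsubmx y).
  by apply/funext => y; rewrite row_mxEr.
have [->|[l ->]] := ord_1n b.
  by rewrite lshift_ord0 (pderiv_rsubmx0 g) -lshift_ord0 block_mxEdl mxE.
by rewrite (pderiv_rsubmx g) block_mxEdr mxE.
Qed.

Lemma Omega_pr_pull k (w : dform M) : Omega k w -> Omega k (pr_pull w : dform N).
Proof.
move=> [sw hw tw]; split=> [i|i z|i j z zij].
- rewrite cyl_chart_img.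
  have oU := open_cyl (open_chart_img hM (i := i)).
  apply: (@smooth_form_pull _ _ _ oU _ _ (fun=> row_mx 0 1%:M) (fun z => w i (rsubmx z))).
    by move=> a b; exact: smooth_cst.
  by move=> S; apply: (smooth_sub _ (smooth_rsubmx (sw i S))) => z [].
- by rewrite cyl_chart_img => -[_ zi]; apply: homog_pull; exact: hw.
have [Iz zij'] : I (z 0 0) /\ overlap_img (i : idx M) j (rsubmx z).
  by move: (zij); rewrite cyl_overlap_img.
rewrite /pr_pull (tw i j) // !pull_comp cyl_jac // cyl_trans // row_mxKr.
by rewrite mul_row_block !mul0mx !mul1mx !add0r mul_mx_row mulmx0 mulmx1.
Qed.

(** The premise is smoothness in the coordinates of the cylinder, rather than [smooth1_on], so that
    powers and inverses of f are covered by [smoothM] and [smoothV]. *)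
Lemma Omega_tfun (h : R -> R) :
  smooth_on [set z : 'rV[R]_(1 + n) | I (z 0 0)] (fun z => h (z 0 0)) ->
  Omega 0 (tfun h : dform N).
Proof.
move=> sh; split=> [i|i z _|i j z zij].
- have oU := open_cyl_chart_img (i := i).
  apply: (smooth_formZ oU (w := fun=> ext1)); last exact: smooth_form_cst.
  by apply: smooth_sub sh; rewrite cyl_chart_img => z [].
- by apply: homogZ; exact: homog_ext1.
by rewrite /tfun cyl_trans // row_mx_const0 pullZ pull_ext1.
Qed.

Lemma Omega_dt : Omega 1 (dt : dform N).
Proof.
split=> [i|i z _|i j z zij].
- exact: smooth_form_cst.
- exact: homog_dx.
rewrite /dt pull_dx cyl_jac //; apply/esym/cov_delta => b.
rewrite -(lshift_ord0 n); have [->|[l ->]] := ord_1n b.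
  by rewrite block_mxEul mxE !eqxx.
rewrite block_mxEur mxE; case: eqP => // /(congr1 val) /=.
Qed.

End CylinderForms.

(** * The exterior derivative in coordinates *)

Section LocalDifferential.
Variables (R : realType) (n : nat) (U : set 'rV[R]_n) (x : 'rV[R]_n).
Hypotheses (oU : open U) (Ux : U x).

Lemma pderiv_sum (T : Type) (r : seq T) (F : T -> 'rV[R]_n -> R) j :
  (forall i, smooth_on U (F i)) ->
  pderiv j (fun y => \sum_(i <- r) F i y) x = \sum_(i <- r) pderiv j (F i) x.
Proof.
move=> sF; elim: r => [|i r IH].
  rewrite big_nil (_ : (fun _ => _) = fun=> 0); first exact: derive_cst.
  by apply/funext => y; rewrite big_nil.
rewrite big_cons -IH (_ : (fun _ => _) = (fun y => F i y + \sum_(i <- r) F i y)).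
  apply: deriveD; first exact: smooth_derivable (sF i) Ux.
  by apply: smooth_derivable Ux; apply: smooth_sum.
by apply/funext => y; rewrite big_cons.
Qed.

Definition pderiv_form m (j : 'I_n) (w : 'rV[R]_n -> ext R m) (y : 'rV[R]_n) : ext R m :=
  [ffun S => pderiv j (fun y => w y S) y].

(** Convertible to [fext], but speaking of one coordinate expression, so that the explicit formula
    for the warped form in a chart can be substituted. *)
Definition dlocal (w : 'rV[R]_n -> ext R n) (y : 'rV[R]_n) : ext R n :=
  \sum_(j < n) wedge (dx R j) (pderiv_form j w y).

(** Each coefficient of [L (w y)] is a combination, with constants read off from the basis, of the
    coefficients of [w y]. Applied to wedging with a constant form and to pulling back along a
    constant matrix. *)
Lemma pd_linear m p (L : ext R m -> ext R p) (w : 'rV[R]_n -> ext R m) j :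
  (forall k a b, L (k *: a + b) = k *: L a + L b) -> smooth_form U w ->
  pderiv_form j (fun y => L (w y)) x = L (pderiv_form j w x).
Proof.
move=> Ll sw.
have L0 : L 0 = 0 by have := Ll (-1) 0 0; rewrite scaler0 addr0 scaleN1r addNr.
have LD a b : L (a + b) = L a + L b by have := Ll 1 a b; rewrite !scale1r.
have LZ (k : R) a : L (k *: a) = k *: L a by have := Ll k a 0; rewrite L0 !addr0.
have LE a : L a = \sum_S a S *: L (ebasis R S).
  by rewrite {1}(ext_basis a) (big_morph L LD L0); apply: eq_bigr => S _; rewrite LZ.
apply/ffunP => S; rewrite ffunE LE sum_ffunE.
have -> : (fun y => L (w y) S) = fun y => \sum_T w y T * L (ebasis R T) S.
  by apply/funext => y; rewrite LE sum_ffunE; apply: eq_bigr => T _; rewrite ffunE.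
rewrite pderiv_sum => [|T]; last by apply: smoothM => //; exact: smooth_cst.
apply: eq_bigr => T _; rewrite !ffunE /pderiv.
rewrite (deriveM (@smooth_derivable _ _ _ _ j _ (sw T) Ux) (derivable_cst _ _ _))
  derive_cst scaler0 add0r.
by rewrite /GRing.scale /= mulrC.
Qed.

Lemma dlocal_add (w v : 'rV[R]_n -> ext R n) : smooth_form U w -> smooth_form U v ->
  dlocal (fun y => w y + v y) x = dlocal w x + dlocal v x.
Proof.
move=> sw sv; rewrite /dlocal -big_split; apply: eq_bigr => j _ /=.
rewrite -wedgeDr; congr wedge; apply/ffunP => S; rewrite !ffunE.
rewrite (_ : (fun _ => _) = fun y => w y S + v y S).
  by apply: deriveD; [exact: smooth_derivable (sw S) Ux|exact: smooth_derivable (sv S) Ux].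
by apply/funext => y; rewrite ffunE.
Qed.

Lemma dlocal_wedge_cst (w : 'rV[R]_n -> ext R n) b : smooth_form U w ->
  dlocal (fun y => wedge (w y) b) x = wedge (dlocal w x) b.
Proof.
move=> sw; rewrite /dlocal wedge_suml; apply: eq_bigr => j _.
rewrite -wedgeA; congr wedge; apply: (pd_linear (L := fun a => wedge a b)) => // k a c.
by rewrite wedgeDl wedgeZl.
Qed.

Lemma dlocal_scale (g : 'rV[R]_n -> R) (w : 'rV[R]_n -> ext R n) :
  smooth_on U g -> smooth_form U w ->
  dlocal (fun y => g y *: w y) x =
  g x *: dlocal w x + wedge (\sum_j pderiv j g x *: dx R j) (w x).
Proof.
move=> sg sw; rewrite /dlocal scaler_sumr wedge_suml -big_split; apply: eq_bigr => j _ /=.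
rewrite wedgeZl -!wedgeZr -wedgeDr; congr wedge; apply/ffunP => S; rewrite !ffunE.
rewrite (_ : (fun _ => _) = fun y => g y * w y S); last first.
  by apply/funext => y; rewrite ffunE.
rewrite /pderiv (deriveM (@smooth_derivable _ _ _ _ j _ sg Ux) (@smooth_derivable _ _ _ _
  j _ (sw S) Ux)).
by rewrite /GRing.scale /= [w x S * _]mulrC.
Qed.

End LocalDifferential.

Section CylinderDifferential.
Variables (R : realType) (n : nat).

Lemma cov_inclr k : cov (inclr R n) k = dx R (rshift 1 k).
Proof.
apply: cov_delta => j; have [->|[l ->]] := ord_1n j.
  by rewrite row_mxEl mxE eq_lrshift.
by rewrite row_mxEr mxE (inj_eq (@rshift_inj _ _)) eq_sym.
Qed.

(** The coefficients do not depend on t, so the dt summand vanishes; the others correspond term by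
    term. *)
Lemma dlocal_pull (U : set 'rV[R]_n) (w : 'rV[R]_n -> ext R n) (z : 'rV[R]_(1 + n)) :
  open U -> U (rsubmx z) -> smooth_form U w ->
  dlocal (fun z : 'rV[R]_(1 + n) => pull (inclr R n) (w (rsubmx z))) z =
  pull (inclr R n) (dlocal w (rsubmx z)).
Proof.
move=> oU Uz sw.
have oU' : open [set z : 'rV[R]_(1 + n) | U (rsubmx z)].
  by apply: (@open_comp _ _ (@rsubmx R 1 1 n)) => // y _; exact: continuous_rsubmx.
have sw' : smooth_form [set z : 'rV[R]_(1 + n) | U (rsubmx z)] (fun z => w (rsubmx z)).
  by move=> S; exact: smooth_rsubmx (sw S).
have pdz j : pderiv_form j (fun z : 'rV[R]_(1 + n) => pull (inclr R n) (w (rsubmx z))) z =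
    pull (inclr R n) (pderiv_form j (fun z : 'rV[R]_(1 + n) => w (rsubmx z)) z).
  apply: (pd_linear oU' Uz) => // k a b; by rewrite pullD pullZ.
rewrite /dlocal pull_sum big_split_ord /= big_ord1 pdz.
have -> : pderiv_form (lshift n 0) (fun z : 'rV[R]_(1 + n) => w (rsubmx z)) z = 0.
  apply/ffunP => S; rewrite !ffunE lshift_ord0.
  exact: (pderiv_rsubmx0 (fun x => w x S)).
rewrite pull0 wedge0r add0r; apply: eq_bigr => k _.
rewrite pdz pull_wedge pull_dx cov_inclr; congr (wedge _ (pull _ _)).
by apply/ffunP => S; rewrite !ffunE; exact: (pderiv_rsubmx (fun x => w x S)).
Qed.

Lemma grad_head (f : R -> R) (z : 'rV[R]_(1 + n)) :
  \sum_j pderiv j (fun z : 'rV[R]_(1 + n) => f (z 0 0)) z *: dx R j =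
  derive1 f (z 0 0) *: dx R (0 : 'I_(1 + n)).
Proof.
rewrite big_split_ord /= big_ord1 lshift_ord0 pderiv_head0 big1 ?addr0 // => k _.
by rewrite pderiv_head scale0r.
Qed.

End CylinderDifferential.

Section Warped.
Variables (R : realType) (I : set R) (f : R -> R) (U : set 'rV[R]_7) (z : 'rV[R]_8).
Variables p q : 'rV[R]_7 -> ext R 7.
Hypotheses (oI : open I) (oU : open U) (Iz : I (z 0 0)) (Uz : U (rsubmx (z : 'rV_(1 + 7)))).
Hypotheses (sf : smooth1_on I f) (sp : smooth_form U p) (sq : smooth_form U q).
Hypothesis hp : forall x, U x -> homog 3 (p x).

Local Notation P := (pull (inclr R 7)).
Local Notation rs y := (rsubmx (y : 'rV[R]_(1 + 7))).
Local Notation d0 := (dx R (0 : 'I_8)).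

(** The derivative of f enters only through f^4: the differential of f^3 is a multiple of dt and
    dies against the factor dt. *)
Lemma dlocal_warped :
  dlocal (fun y : 'rV[R]_8 => f (y 0 0) ^+ 3 *: wedge (P (p (rs y))) d0
     + f (y 0 0) ^+ 4 *: P (q (rs y))) z =
  f (z 0 0) ^+ 3 *: wedge (P (dlocal p (rs z))) d0
  + f (z 0 0) ^+ 4 *: P (dlocal q (rs z))
  + (4%:R * f (z 0 0) ^+ 3 * derive1 f (z 0 0)) *: wedge d0 (P (q (rs z))).
Proof.
pose W := [set y : 'rV[R]_8 | I (y 0 0) /\ U (rs y)].
have oW : open W by exact: (open_cyl oI oU).
have Wz : W z by [].
have sr (w : 'rV[R]_7 -> ext R 7) : smooth_form U w ->
    smooth_form W (fun y : 'rV[R]_8 => P (w (rs y))).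
  move=> sw; apply: (@smooth_form_pull _ _ _ oW _ _ (fun=> inclr R 7) (fun y => w (rs y))).
    by move=> a b; exact: smooth_cst.
  by move=> S; apply: (smooth_sub _ (smooth_rsubmx (sw S))) => y [].
have sF : smooth_on W (fun y : 'rV[R]_8 => f (y 0 0)).
  by apply: smooth_sub (@smooth_head R 7 I f sf) => y [].
have sX k : smooth_on W (fun y : 'rV[R]_8 => f (y 0 0) ^+ k).
  elim: k => [|k IH]; first by apply: (smooth_ext oW) (smooth_cst _ 1) => y _; rewrite expr0.
  by apply: (smooth_ext oW) (smoothM oW sF IH) => y _; rewrite exprS.
have df : derivable f (z 0 0) 1 by exact: (sf (k := 0)).
have s1 : smooth_form W (fun y : 'rV[R]_8 => wedge (P (p (rs y))) d0).
  by apply: smooth_form_wedge => //; [exact: sr|exact: smooth_form_cst].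
have gX k : \sum_j pderiv j (fun y : 'rV[R]_8 => f (y 0 0) ^+ k.+1) z *: dx R j =
    (k.+1%:R * f (z 0 0) ^+ k * derive1 f (z 0 0)) *: d0.
  rewrite (@grad_head R 7 (fun t => f t ^+ k.+1) z) derive1E; congr (_ *: _).
  have -> : (fun t => f t ^+ k.+1) = f ^+ k.+1 by apply/funext => t; rewrite exprfctE.
  by rewrite (deriveX k.+1 df) derive1E /GRing.scale /= mulrC mulr_natl.
rewrite (dlocal_add Wz); [|by apply: smooth_formZ => //; exact: sX|
  by apply: smooth_formZ => //; exact: sr].
rewrite (dlocal_scale Wz (sX 3%N) s1) (dlocal_scale Wz (sX 4%N) (sr _ sq)) !gX.
rewrite (dlocal_wedge_cst oW Wz _ (sr _ sp)) !(dlocal_pull oU Uz) // !wedgeZl.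
rewrite (_ : wedge d0 (wedge _ d0) = 0) ?scaler0 ?addr0 ?addrA //.
rewrite wedgeA (wedgeC (homog_dx R _) (homog_pull _ (hp Uz))) wedgeZl -wedgeA.
by rewrite wedge_dx_sq wedge0r scaler0.
Qed.

End Warped.

(** * The warped structure *)

Section WarpedStructure.
Variables (R : realType) (M : atlas R 7) (phi : dform M) (I : set R) (f : R -> R).
Hypotheses (hM : manifold M) (hphi : g2_structure phi) (oI : open I)
  (hf : smooth1_on I f) (hf0 : forall t, I t -> f t != 0).
Local Notation N := (cylinder I M).
Local Notation psi := (star7 phi phi).
Local Notation P := (pull (inclr R 7)).
Local Notation rs z := (rsubmx (z : 'rV[R]_(1 + 7))).
Local Notation d0 := (dx R (0 : 'I_8)).

Let oM : forall i : idx M, open (chart_img i) := open_chart_img hM.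
Let oN : forall i : idx N, open (chart_img i) := open_cyl_chart_img hM oI.

Lemma wedge_ext1Z n (c : R) (a : ext R n) : wedge (c *: ext1) a = c *: a.
Proof. by rewrite wedgeZl wedge1l. Qed.

Lemma warpedE (i : idx N) z : warped f phi i z =
  f (z 0 0) ^+ 3 *: wedge (P (phi i (rs z))) d0 + f (z 0 0) ^+ 4 *: P (psi i (rs z)).
Proof. by rewrite /warped faddE !fwedgeE !wedge_ext1Z wedgeZl. Qed.

Lemma warped_adapted (i : idx N) z E : chart_img i z ->
  adapted g2_model (phi i (rs z)) E ->
  warped f phi i z =
    f (z 0 0) ^+ 3 *: wedge (pull (E *m inclr R 7) g2_model) d0
    + f (z 0 0) ^+ 4 *: pull (E *m inclr R 7) (std_hodge g2_model)
  /\ adapted spin7_model (warped f phi i z) (spin7_frame (f (z 0 0)) E).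
Proof.
rewrite cyl_chart_img => -[Iz iz] aE; have [uE phiE] := aE.
have WE : warped f phi i z =
    f (z 0 0) ^+ 3 *: wedge (pull (E *m inclr R 7) g2_model) d0
    + f (z 0 0) ^+ 4 *: pull (E *m inclr R 7) (std_hodge g2_model).
  by rewrite warpedE (star7_phiE hphi iz aE) phiE !pull_comp.
by split=> //; rewrite WE; apply: adapted_spin7_frame => //; exact: hf0.
Qed.

Let oH : open [set z : 'rV[R]_8 | I (z 0 0)].
Proof.
by apply: (@open_comp _ _ (fun z : 'rV[R]_8 => z 0 0)) => // z _; exact: coord_continuous.
Qed.

Let sf : smooth_on [set z : 'rV[R]_8 | I (z 0 0)] (fun z => f (z 0 0)).
Proof. exact: (@smooth_head R 7). Qed.

Let Omega_fX k : Omega 0 (tfun (fun t => f t ^+ k) : dform N).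
Proof.
apply: (@Omega_tfun R 7 I M hM oI); elim: k => [|k IH].
  by apply: (smooth_ext oH) (smooth_cst _ 1) => y _; rewrite expr0.
by apply: (smooth_ext oH) (smoothM oH sf IH) => y _; rewrite exprS.
Qed.

Let Omega_fV : Omega 0 (tfun (fun t => (f t)^-1) : dform N).
Proof. by apply: (@Omega_tfun R 7 I M hM oI); apply: smoothV => // z; exact: hf0. Qed.

Let Omega_df : Omega 0 (tfun (derive1 f) : dform N).
Proof.
apply: (@Omega_tfun R 7 I M hM oI); apply: (@smooth_head R 7) => k t It.
by rewrite -derive1Sn; exact: hf.
Qed.

Lemma Omega_warped : Omega 4 (warped f phi : dform N).
Proof.
apply: OmegaD => //.
  apply: (@Omega_wedge _ _ _ oN 3 1); last exact: Omega_dt.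
  apply: (@Omega_wedge _ _ _ oN 0 3) => //; apply: Omega_pr_pull => //.
  exact: hphi.1.
apply: (@Omega_wedge _ _ _ oN 0 4) => //; apply: Omega_pr_pull => //.
exact: Omega_star7_phi.
Qed.

Lemma spin7_warped : spin7_structure (warped f phi : dform N).
Proof.
split=> [|i z]; first exact: Omega_warped.
rewrite cyl_chart_img => -[Iz iz].
have [V [E [oV Vz VU sE aE]]] := hphi.2 i _ iz.
pose W := [set y : 'rV[R]_8 | I (y 0 0) /\ V (rs y)].
have oW : open W by exact: (open_cyl oI oV).
exists W, (fun y : 'rV[R]_8 => spin7_frame (f (y 0 0)) (E (rs y))); split;
  [exact: oW|by split| | |].
- by move=> y [Iy Vy]; split=> //; exact: VU.
- move=> a b; case: (splitP (a : 'I_(7 + 1))) => k ak.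
    have -> : a = lshift 1 k by exact: val_inj.
    have [->|[l ->]] := ord_1n b.
      apply: (smooth_ext oW) (smooth_cst _ 0) => y _.
      by rewrite spin7_frameEu row_mxEl mxE mulr0.
    have sf' : smooth_on W (fun y : 'rV[R]_8 => f (y 0 0)) by apply: smooth_sub sf => y [].
    have sE' : smooth_on W (fun y : 'rV[R]_8 => E (rs y) k l).
      by apply: smooth_sub (smooth_rsubmx (sE k l)) => y [].
    by apply: (smooth_ext oW) (smoothM oW sf' sE') => y _; rewrite spin7_frameEu row_mxEr.
  have -> : a = rshift 7 0 by apply: val_inj; rewrite /= ak ord1.
  by apply: (smooth_ext oW) (smooth_cst _ (b == 0)%:R) => y _; rewrite spin7_frameEd.
move=> y [Iy Vy].
have iy : chart_img i y by rewrite cyl_chart_img; split=> //; exact: VU.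
exact: (warped_adapted iy (aE _ Vy)).2.
Qed.

(** * The torsion forms of the warped structure *)

Section Torsion.
Variables (tau0 tau1 tau2 tau3 : dform M).
Hypothesis htau : g2_torsion phi tau0 tau1 tau2 tau3.

Definition warped_lambda1 : dform N :=
  tfun (fun t => (f t)^-1) \^ (pr_pull tau0 + 4%:R *: tfun (derive1 f)) \^ dt
  + (24%:R / 7%:R) *: pr_pull tau1.

Definition warped_lambda5 : dform N :=
  - (3%:R / 7%:R) *: (tfun (fun t => f t ^+ 3) \^ pr_pull tau1 \^ pr_pull phi \^ dt)
  + (4%:R / 7%:R) *: (tfun (fun t => f t ^+ 4) \^ pr_pull tau1 \^ pr_pull (star7 phi phi))
  + tfun (fun t => f t ^+ 4) \^ pr_pull tau2 \^ pr_pull phi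
  + tfun (fun t => f t ^+ 3) \^ pr_pull (star7 phi tau3) \^ dt.

Lemma warped_lambda1E (i : idx N) z : warped_lambda1 i z =
  (f (z 0 0))^-1 *: wedge (P (tau0 i (rs z)) + (4%:R * derive1 f (z 0 0)) *: ext1) d0
  + (24%:R / 7%:R) *: P (tau1 i (rs z)).
Proof.
by rewrite /warped_lambda1 !(faddE, fscaleE, fwedgeE) wedge_ext1Z wedgeZl scalerA.
Qed.

Lemma warped_lambda5E (i : idx N) z : warped_lambda5 i z =
  - (3%:R / 7%:R) *: (f (z 0 0) ^+ 3 *:
      wedge (wedge (P (tau1 i (rs z))) (P (phi i (rs z)))) d0)
  + (4%:R / 7%:R) *: (f (z 0 0) ^+ 4 *: wedge (P (tau1 i (rs z))) (P (psi i (rs z))))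
  + f (z 0 0) ^+ 4 *: wedge (P (tau2 i (rs z))) (P (phi i (rs z)))
  + f (z 0 0) ^+ 3 *: wedge (P (star7 phi tau3 i (rs z))) d0.
Proof.
by rewrite /warped_lambda5 !(faddE, fscaleE, fwedgeE) !(wedge_ext1Z, wedgeZl).
Qed.

Lemma Omega_warped_lambda1 : Omega 1 warped_lambda1.
Proof.
have [[om0 om1 _ _] _] := htau.
apply: OmegaD => //; last by apply: OmegaZ => //; exact: Omega_pr_pull.
apply: (@Omega_wedge _ _ _ oN 0 1); last exact: Omega_dt.
apply: (@Omega_wedge _ _ _ oN 0 0) => //; apply: OmegaD => //.
  exact: Omega_pr_pull.
exact: OmegaZ.
Qed.

Lemma Omega_warped_lambda5 : Omega 5 warped_lambda5.
Proof.
have [[om0 om1 [om2 _] [om3 _ _]] _] := htau.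
have Op : Omega 3 (pr_pull phi : dform N) by apply: Omega_pr_pull => //; exact: hphi.1.
have Oq : Omega 4 (pr_pull psi : dform N) by apply: Omega_pr_pull => //; exact: Omega_star7_phi.
have Od : Omega 1 (dt : dform N) by exact: Omega_dt.
have Ou : Omega 4 (pr_pull (star7 phi tau3) : dform N).
  by apply: Omega_pr_pull => //; exact: (Omega_star7_tau3 oM hphi htau).
have Os : Omega 1 (pr_pull tau1 : dform N) by exact: Omega_pr_pull.
have Or : Omega 2 (pr_pull tau2 : dform N) by exact: Omega_pr_pull.
apply: OmegaD => //; last first.
  by apply: (@Omega_wedge _ _ _ oN 4 1) => //; apply: (@Omega_wedge _ _ _ oN 0 4).
apply: OmegaD => //; last first.
  by apply: (@Omega_wedge _ _ _ oN 2 3) => //; apply: (@Omega_wedge _ _ _ oN 0 2).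
apply: OmegaD => //; apply: OmegaZ => //; last first.
  by apply: (@Omega_wedge _ _ _ oN 1 4) => //; apply: (@Omega_wedge _ _ _ oN 0 1).
apply: (@Omega_wedge _ _ _ oN 4 1) => //; apply: (@Omega_wedge _ _ _ oN 1 3) => //.
exact: (@Omega_wedge _ _ _ oN 0 1).
Qed.

(** In an adapted coframe E the values of the torsion forms are pullbacks of forms satisfying the
    model conditions. Everything then comes from R^7 through the single matrix [E *m inclr R 7]. *)
Lemma contract_warped (i : idx N) z v : chart_img i z ->
  wedge (contract v (warped f phi i z)) (warped_lambda5 i z) = 0.
Proof.
move=> iz; have [Iz iz'] : I (z 0 0) /\ chart_img (i : idx M) (rs z).
  by move: iz; rewrite cyl_chart_img.
have [E aE] := g2_adapted_ex hphi iz'; have [uE phiE] := aE.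
have [[_ [_ h1 _] [[_ h2 _] t2] [[_ h3 _] t3 t3']] _] := htau.
have psiE := star7_phiE hphi iz' aE.
have ex k a : homog k a -> exists b, homog k b /\ a = pull E b.
  by move=> ha; exists (pull (invmx E) a); rewrite pullVK //; split=> //; exact: homog_pull.
have inj0 a : pull E a = 0 -> a = 0.
  by move=> Ea; rewrite -(pullK a uE) Ea pull0.
rewrite (warped_adapted iz aE).1 warped_lambda5E (star7E hphi iz' (h3 _ _ iz') aE).
have [s1 [hs1 E1]] := ex _ _ (h1 _ _ iz').
have [s2 [hs2 E2]] := ex _ _ (h2 _ _ iz').
have [s3 [hs3 E3]] := ex _ _ (h3 _ _ iz').
have {}t2 : wedge (tau2 i (rs z)) (psi i (rs z)) = 0 by exact: t2 iz'.
have {}t3 : wedge (tau3 i (rs z)) (phi i (rs z)) = 0 by exact: t3 iz'.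
have {}t3' : wedge (tau3 i (rs z)) (psi i (rs z)) = 0 by exact: t3' iz'.
rewrite psiE phiE E1 E2 E3 in t2 t3 t3' *.
rewrite /coframe_hodge (pullK _ uE) !pull_comp.
by apply: contract_warped_lambda5 => //; apply: inj0; rewrite pull_wedge.
Qed.

Lemma homog0_ext1 n (a : ext R n) : homog 0 a -> a = a finset.set0 *: ext1.
Proof.
move=> ha; apply/ffunP => S; rewrite !ffunE.
have [->|S0] := eqVneq S finset.set0; first by rewrite /GRing.scale /= mulr1.
by rewrite scaler0 ha // cards_eq0.
Qed.

Lemma fextE n (L : atlas R n) (w : dform L) i x : fext w i x = dlocal (w i) x.
Proof. by []. Qed.

Lemma fext_warped (i : idx N) z : chart_img i z ->
  fext (warped f phi) i z = wedge (warped_lambda1 i z) (warped f phi i z) + warped_lambda5 i z.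
Proof.
move=> iz; have [Iz iz'] : I (z 0 0) /\ chart_img (i : idx M) (rs z).
  by move: iz; rewrite cyl_chart_img.
have f0 := hf0 Iz.
have [[sp hp _] _] := hphi; have sq := smooth_star7_phi hphi.
have [[[_ h0 _] [_ h1 _] _ _] [dphi dpsi]] := htau.
have WE : warped f phi i = fun y : 'rV[R]_8 =>
    f (y 0 0) ^+ 3 *: wedge (P (phi i (rs y))) d0 + f (y 0 0) ^+ 4 *: P (psi i (rs y)).
  by apply/funext => y; exact: warpedE.
rewrite fextE WE (dlocal_warped oI (@oM i) Iz iz' hf (sp i) (sq i) (hp i)).
rewrite -!fextE dphi // dpsi //.
rewrite !(faddE, fscaleE, fwedgeE) warped_lambda1E warped_lambda5E.
rewrite (homog0_ext1 (h0 _ _ iz')); set c := tau0 i (rs z) finset.set0.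
rewrite !(pullD, pullZ, pull_wedge, pull_ext1).
have hpP := homog_pull (inclr R 7) (hp i _ iz').
have hqP := homog_pull (inclr R 7) (let: And3 _ h _ := Omega_star7_phi hphi in h i _ iz').
have dq := wedgeC (homog_dx R (0 : 'I_8)) hqP.
have dpd : wedge d0 (wedge (P (phi i (rs z))) d0) = 0.
  by rewrite wedgeA (wedgeC (homog_dx R _) hpP) wedgeZl -wedgeA wedge_dx_sq wedge0r scaler0.
set p := P (phi i _) in dpd *; set q := P (psi i _) in dq *.
set s := P (tau1 i _); set r := P (tau2 i _); set u := P (star7 phi tau3 i _).
set F := f (z 0 0) in f0 *; set F' := derive1 f (z 0 0).
rewrite -signr_odd /= expr0 scale1r in dq.
rewrite !(wedgeDl, wedgeZl, wedgeDr, wedgeZr, wedge1l) -!wedgeA dpd dq.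
(* The five surviving products become unknowns and their scalar coefficients are compared. For tau1
   this is 24/7 - 3/7 = 3 and 24/7 + 4/7 = 4; for tau0 the factor 1/f cancels against f^4. *)
move: (wedge q _) (wedge s (wedge p _)) (wedge u _) (wedge s q) (wedge r p) => x1 x2 x3 x4 x5.
apply/ffunP => S; rewrite !ffunE /GRing.scale /=.
by field.
Qed.

Theorem warped_torsion (lambda1 lambda5 : dform N) :
  spin7_torsion (warped f phi) lambda1 lambda5 <->
  lambda1 =f warped_lambda1 /\ lambda5 =f warped_lambda5.
Proof.
(* An adapted coframe exists at every point, so the one selected in [star8] is adapted and not the
   default [1%:M]. *)
have aN (i : idx N) z : chart_img i z ->
    adapted spin7_model (warped f phi i z)
      (xget 1%:M (adapted spin7_model (warped f phi i z))).
  move=> iz; apply: xgetPex; have [_ /(_ i z iz)[V [E [_ Vz _ _ aE]]]] := spin7_warped.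
  by exists (E z); exact: aE.
split=> [[[_ h1 _] [[_ h5 _] sd] dW]|[E1 E5]].
  have H (i : idx N) z : chart_img i z -> lambda1 i z = warped_lambda1 i z.
    move=> iz; apply/eqP; rewrite -subr_eq0; apply/eqP.
    apply: (spin7_wedge_inj_adapted (aN _ _ iz)).
      apply: homogD; first exact: h1.
      by apply: homogN; have [_ h _] := Omega_warped_lambda1; exact: h.
    move=> v; have dE : wedge (lambda1 i z) (warped f phi i z) + lambda5 i z =
        wedge (warped_lambda1 i z) (warped f phi i z) + warped_lambda5 i z.
      by rewrite -fext_warped // dW.
    (* Subtracting the two decompositions of d Phi turns the unknown product into a difference of
       two components of type lambda5, both annihilated by every i_v Phi. *)
    have -> : wedge (lambda1 i z - warped_lambda1 i z) (warped f phi i z) =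
        warped_lambda5 i z - lambda5 i z.
      rewrite wedgeDl wedgeNl; apply/eqP; rewrite subr_eq addrAC [_ + wedge _ _]addrC -dE.
      by rewrite addrK.
    rewrite wedgeDr wedgeNr contract_warped // sub0r.
    rewrite (iffLR (spin7_48_adapted (aN _ _ iz) (h5 _ _ iz))) ?oppr0 //.
    exact: (sd i z iz).
  split=> // i z iz.
  have := dW i z iz; rewrite fext_warped // faddE fwedgeE H //.
  by move/addrI.
split.
- by apply: (Omega_ext oN _ Omega_warped_lambda1) => i z iz; rewrite E1.
- have O5 : Omega 5 lambda5.
    by apply: (Omega_ext oN _ Omega_warped_lambda5) => i z iz; rewrite E5.
  split=> // i z iz; rewrite fwedgeE; have [_ h5 _] := O5.
  apply/(spin7_48_adapted (aN _ _ iz) (h5 _ _ iz)) => v.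
  by rewrite E5 // contract_warped.
- by move=> i z iz; rewrite fext_warped // faddE fwedgeE E1 // E5.
Qed.

End Torsion.
End WarpedStructure.

Theorem theorem6p3 (R : realType) (M : atlas R 7)
    (phi tau0 tau1 tau2 tau3 : dform M) (I : set R) (f : R -> R)
    (hM : manifold M) (hphi : g2_structure phi)
    (htau : g2_torsion phi tau0 tau1 tau2 tau3)
    (hIo : open I) (hI : is_interval I) (hf : smooth1_on I f)
    (hf0 : forall t, I t -> f t != 0)
    (hfnc : exists s t, [/\ I s, I t & f s != f t]) :
  let Phi : dform (cylinder I M) := warped f phi in
  spin7_structure Phi /\
  forall lambda1 lambda5 : dform (cylinder I M),
    spin7_torsion Phi lambda1 lambda5 <->
    lambda1 =f
      tfun (fun t => (f t)^-1)
        \^ (pr_pull tau0 + 4%:R *: tfun (derive1 f)) \^ dt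
      + (24%:R / 7%:R) *: pr_pull tau1
    /\
    lambda5 =f
      - (3%:R / 7%:R) *:
          (tfun (fun t => f t ^+ 3) \^ pr_pull tau1 \^ pr_pull phi \^ dt)
      + (4%:R / 7%:R) *:
          (tfun (fun t => f t ^+ 4) \^ pr_pull tau1
             \^ pr_pull (star7 phi phi))
      + tfun (fun t => f t ^+ 4) \^ pr_pull tau2 \^ pr_pull phi
      + tfun (fun t => f t ^+ 3) \^ pr_pull (star7 phi tau3) \^ dt.
Proof.
move=> Phi; split; first exact: spin7_warped.
by move=> lambda1 lambda5; exact: warped_torsion.
Qed.
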